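(* Define the formal power series $$\chi(y,\kappa):=y+\sum_{n=3}^{\infty}n\,\kappa\,y^{n-1}\,\widetilde\chi_{0,n}(\kappa).$$ Then $\chi=\chi(y,\kappa)$ satisfies $$\kappa(1+\chi)\log(1+\chi)=(\kappa+1)\chi-y.$$
   Context: Stable graphs: a stable graph is a finite graph (loops and multiple edges allowed) with internal edges, each joining two (possibly equal) vertices, and unlabelled external edges, each attached to one vertex. Each vertex $v$ carries a genus $g_v\in\mathbb Z_{\ge0}$; its valence $\mathrm{val}_v$ is the number of half-edges at $v$ (an external edge counts once, a loop twice); stability means $2g_v-2+\mathrm{val}_v>0$ for every $v$. The genus of a connected stable graph $\Gamma$ is $h^1(\Gamma)+\sum_v g_v$. $\mathcal G^c_{g,n}$ is the (finite) set of isomorphism classes of connected stable graphs of genus $g$ with $n$ external edges, $V(\Gamma)$ and $E(\Gamma)$ are the sets of vertices and internal edges, and $\mathrm{Aut}(\Gamma)$ is the automorphism group (acting on vertices and half-edges; external edges may be permuted). For $2g-2+n>0$, $\chi(\mathcal M_{g,n})$ is the orbifold Euler characteristic of the moduli space of smooth genus $g$ curves with $n$ marked points, given by the Harer–Zagier formula $\chi(\mathcal M_{g,n})=(-1)^n\frac{(2g-1)B_{2g}}{(2g)!}(2g+n-3)!$. The refined orbifold Euler characteristic (at $t=1$) is the polynomial $$\widetilde\chi_{g,n}(\kappa):=\sum_{\Gamma\in\mathcal G^c_{g,n}}\frac{\kappa^{|E(\Gamma)|}}{|\mathrm{Aut}(\Gamma)|}\prod_{v\in V(\Gamma)}\chi(\mathcal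 M_{g_v,\mathrm{val}_v}).$$ *)

(* Defs.v *)
From HB Require Import structures.
From mathcomp Require Export all_boot all_order all_algebra perm.
From mathcomp Require Export boolp classical_sets functions cardinality fsbigop.

Set Implicit Arguments.
Unset Strict Implicit.
Unset Printing Implicit Defensive.

Import Order.TTheory GRing.Theory Num.Theory.

Local Open Scope ring_scope.

(* Formal power series over R in one variable, given by their coefficients. A
   record is used because nat -> R already carries the pointwise product. *)
Record fps (R : Type) := FPS { fcoef : nat -> R }.

HB.instance Definition _ (R : Type) := gen_eqMixin (fps R).
HB.instance Definition _ (R : Type) := gen_choiceMixin (fps R).

Lemma fpsP (R : Type) (f g : fps R) :
  (forall n, fcoef f n = fcoef g n) -> f = g.
Proof. by case: f g => f [g] /= /funext ->. Qed.

Section FpsRing.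
Variable R : comNzRingType.
Implicit Types f g h : fps R.

Definition fps_zero : fps R := FPS (fun=> 0).
Definition fps_one : fps R := FPS (fun n => (n == 0%N)%:R).
Definition fps_opp f : fps R := FPS (fun n => - fcoef f n).
Definition fps_add f g : fps R := FPS (fun n => fcoef f n + fcoef g n).
Definition fps_mul f g : fps R :=
  FPS (fun n => \sum_(i < n.+1) fcoef f i * fcoef g (n - i)).

Fact fps_addA : associative fps_add.
Proof. by move=> f g h; apply: fpsP => n; apply: addrA. Qed.

Fact fps_addC : commutative fps_add.
Proof. by move=> f g; apply: fpsP => n; apply: addrC. Qed.

Fact fps_add0 : left_id fps_zero fps_add.
Proof. by move=> f; apply: fpsP => n; apply: add0r. Qed.

Fact fps_addN : left_inverse fps_zero fps_opp fps_add.
Proof. by move=> f; apply: fpsP => n; apply: addNr. Qed.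

HB.instance Definition _ :=
  GRing.isZmodule.Build (fps R) fps_addA fps_addC fps_add0 fps_addN.

Definition fps_trunc n f : {poly R} := \poly_(i < n.+1) fcoef f i.

Lemma coef_fps_trunc n f i :
  (i <= n)%N -> (fps_trunc n f)`_i = fcoef f i.
Proof. by move=> le_in; rewrite coef_poly ltnS le_in. Qed.

Lemma fcoef_mul_trunc n f g i : (i <= n)%N ->
  fcoef (fps_mul f g) i = (fps_trunc n f * fps_trunc n g)`_i.
Proof.
move=> le_in; rewrite coefM; apply: eq_bigr => j _.
rewrite !coef_fps_trunc //; first exact: leq_trans (leq_subr _ _) le_in.
by rewrite (leq_trans _ le_in) // -ltnS.
Qed.

Fact fps_mulA : associative fps_mul.
Proof.
move=> f g h; apply: fpsP => n.
have -> : fcoef (fps_mul f (fps_mul g h)) n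
    = (fps_trunc n f * (fps_trunc n g * fps_trunc n h))`_n.
  rewrite coefM; apply: eq_bigr => j _.
  by rewrite coef_fps_trunc -1?ltnS // (@fcoef_mul_trunc n) ?leq_subr.
rewrite mulrA coefM; apply: eq_bigr => j _.
by rewrite coef_fps_trunc ?leq_subr // (@fcoef_mul_trunc n) // -ltnS.
Qed.

Fact fps_mulC : commutative fps_mul.
Proof.
move=> f g; apply: fpsP => n.
by rewrite !(@fcoef_mul_trunc n) // mulrC.
Qed.

Fact fps_mul1 : left_id fps_one fps_mul.
Proof.
move=> f; apply: fpsP => n /=; rewrite big_ord_recl /= mul1r subn0.
by rewrite big1 ?addr0 // => i _; rewrite mul0r.
Qed.

Fact fps_mulDl : left_distributive fps_mul fps_add.
Proof.
move=> f g h; apply: fpsP => n /=; rewrite -big_split.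
by apply: eq_bigr => i _; rewrite mulrDl.
Qed.

Fact fps_one_neq0 : fps_one != 0 :> fps R.
Proof. by apply/eqP => -[] /(congr1 (@^~ 0%N)) /eqP; rewrite oner_eq0. Qed.

HB.instance Definition _ := GRing.Zmodule_isComNzRing.Build (fps R)
  fps_mulA fps_mulC fps_mul1 fps_mulDl fps_one_neq0.

Definition fpsC (c : R) : fps R := FPS (fun n => if n == 0%N then c else 0).

Definition fpsX : fps R := FPS (fun n => (n == 1%N)%:R).

End FpsRing.

Arguments fpsX {R}.

(* log (1 + f) = \sum_(k >= 1) (-1)^(k-1) f^k / k. It is meaningful only when
   fcoef f 0 = 0; then f ^+ k has no coefficient below k, so that only the
   terms with k <= n contribute to the coefficient n. *)
Definition fps_log1p (f : fps {poly rat}) : fps {poly rat} :=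
  FPS (fun n =>
    \sum_(1 <= k < n.+1) ((-1) ^+ k.-1 / k%:R) *: fcoef (f ^+ k) n).

(* The first n Bernoulli numbers, from
   \sum_(k <= m) 'C(m + 1, k) B_k = (m == 0). *)
Fixpoint bernoulli_seq (n : nat) : seq rat :=
  if n is m.+1 then
    let s := bernoulli_seq m in
    rcons s (((m == 0%N)%:R - \sum_(k < m) 'C(m.+1, k)%:R * s`_k) / m.+1%:R)
  else [::].

Definition bernoulli (n : nat) : rat := (bernoulli_seq n.+1)`_n.

Lemma size_bernoulli_seq n : size (bernoulli_seq n) = n.
Proof. by elim: n => //= n IHn; rewrite size_rcons IHn. Qed.

Lemma nth_bernoulli_seq n k :
  (k < n)%N -> (bernoulli_seq n)`_k = bernoulli k.
Proof.
elim: n => // n IHn; rewrite ltnS leq_eqVlt => /predU1P[-> //|lt_kn].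
by rewrite /= nth_rcons size_bernoulli_seq lt_kn IHn.
Qed.

Lemma bernoulliE n :
  \sum_(k < n.+1) 'C(n.+1, k)%:R * bernoulli k = (n == 0%N)%:R.
Proof.
rewrite big_ord_recr /= {2}/bernoulli /= nth_rcons size_bernoulli_seq ltnn eqxx.
rewrite binSn mulrC divfK ?pnatr_eq0 //.
rewrite (eq_bigr (fun k : 'I_n => 'C(n.+1, k)%:R * (bernoulli_seq n)`_k)).
  by rewrite addrC subrK.
by move=> k _; rewrite nth_bernoulli_seq.
Qed.

(* Harer-Zagier formula, for 2g - 2 + n > 0. *)
Definition chi_M (g n : nat) : rat :=
  (-1) ^+ n * ((2 * g%:R - 1) * bernoulli (2 * g) / (2 * g)`!%:R)
  * (2 * g + n - 3)`!%:R.

(* Up to isomorphism the vertices and the half-edges of a stable graph are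
   ordinals. flip is the involution whose fixed points are the external edges
   and whose orbits of size 2 are the internal edges. The inequality in
   stableP is 2 g_v - 2 + val_v > 0. *)
Record stable_graph := StableGraph {
  nvert : nat;
  nhalf : nat;
  att : 'I_nhalf -> 'I_nvert;
  flip : 'I_nhalf -> 'I_nhalf;
  vgenus : 'I_nvert -> nat;
  flipK : involutive flip;
  stableP : forall v, (2 < 2 * vgenus v + #|[set h | att h == v]|)%N
}.

HB.instance Definition _ := gen_eqMixin stable_graph.
HB.instance Definition _ := gen_choiceMixin stable_graph.

Section StableGraph.
Variable G : stable_graph.

Definition valence (v : 'I_(nvert G)) : nat := #|[set h | att h == v]|.

Definition ext_edges : {set 'I_(nhalf G)} := [set h | flip h == h].

Definition int_edges : {set {set 'I_(nhalf G)}} :=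
  [set [set h; flip h] | h : 'I_(nhalf G) & flip h != h].

Definition adj : rel 'I_(nvert G) :=
  fun u v => [exists h, (att h == u) && (att (flip h) == v)].

Definition ncomp : nat := n_comp adj predT.

Definition sg_connected : bool := ncomp == 1%N.

Definition betti1 : int := #|int_edges|%:Z - (nvert G)%:Z + ncomp%:Z.

Definition sg_genus : int := betti1 + \sum_(v < nvert G) (vgenus v)%:Z.

Definition sg_aut :=
  [set p : {perm 'I_(nvert G)} * {perm 'I_(nhalf G)} |
    [&& [forall h, att (p.2 h) == p.1 (att h)],
        [forall h, flip (p.2 h) == p.2 (flip h)]
      & [forall v, vgenus (p.1 v) == vgenus v]]].

End StableGraph.

Definition sg_iso (G G' : stable_graph) : Prop :=
  exists (a : 'I_(nvert G) -> 'I_(nvert G'))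
         (b : 'I_(nhalf G) -> 'I_(nhalf G')),
    [/\ bijective a, bijective b,
        forall h, att (b h) = a (att h),
        forall h, flip (b h) = b (flip h)
      & forall v, vgenus (a v) = vgenus v].

Definition sg_isob (G G' : stable_graph) : bool := `[< sg_iso G G' >].

Fact sg_isob_refl : reflexive sg_isob.
Proof.
by move=> G; apply/asboolP; exists id, id; split=> //; exists id.
Qed.

Fact sg_iso_sym G G' : sg_iso G G' -> sg_iso G' G.
Proof.
case=> a [b [[a' aK a'K] [b' bK b'K] Ha Hf Hg]].
exists a', b'; split; [by exists a | by exists b | move=> h | move=> h | move=> v].
- by rewrite -{2}(b'K h) Ha aK.
- by rewrite -{2}(b'K h) Hf bK.
- by rewrite -{2}(a'K v) Hg.
Qed.

Fact sg_isob_sym : symmetric sg_isob.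
Proof. by move=> G G'; apply/asboolP/asboolP; apply: sg_iso_sym. Qed.

Fact sg_isob_trans : transitive sg_isob.
Proof.
move=> G2 G1 G3 /asboolP[a [b [Ha Hb Hatt Hflip Hg]]].
case/asboolP=> a' [b' [Ha' Hb' Hatt' Hflip' Hg']].
apply/asboolP; exists (a' \o a), (b' \o b); split=> [||h|h|v] /=.
- exact: bij_comp.
- exact: bij_comp.
- by rewrite Hatt' Hatt.
- by rewrite Hflip' Hflip.
- by rewrite Hg' Hg.
Qed.

Canonical sg_iso_equiv :=
  EquivRel sg_isob sg_isob_refl sg_isob_sym sg_isob_trans.

Definition sg_class := {eq_quot sg_iso_equiv}%qT.

Definition conn_classes (g n : nat) : set sg_class :=
  [set \pi_sg_class%qT G | G in
    [set G | [/\ sg_connected G, sg_genus G = g%:Z & #|ext_edges G| = n]]]%classic.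

(* A polynomial in kappa = 'X. The summand is invariant under isomorphism and
   conn_classes g n is finite when 2g - 2 + n > 0, so that neither the choice of
   repr c nor the value of \sum_(_ \in _) on infinite supports matters. *)
Definition chi_refined (g n : nat) : {poly rat} :=
  \sum_(c \in conn_classes g n)
    let G := repr c in
    ((\prod_(v < nvert G) chi_M (vgenus v) (valence v)) / #|sg_aut G|%:R)
      *: 'X^#|int_edges G|.

(* y + \sum_(n >= 3) n kappa y^(n-1) chi_refined 0 n, as a power series in y
   over Q[kappa]; the coefficient m comes from n = m + 1. *)
Definition chi_series : fps {poly rat} :=
  fpsX + FPS (fun m =>
    if (3 <= m.+1)%N then m.+1%:R * 'X * chi_refined 0 m.+1 else 0).

(* Main.v *)
From HB Require Import structures.
Require Import Defs.
From mathcomp Require Import fintype finset fingraph.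
From mathcomp Require Import ring lra zify.
Set Implicit Arguments.
Unset Strict Implicit.
Unset Printing Implicit Defensive.
Import Order.TTheory GRing.Theory Num.Theory.
Local Open Scope ring_scope.

(** Let w_d = chi(M_(0,d)) = (-1)^(d-3) (d-3)!, so that
    phi(x) = sum_(d >= 3) w_d x^(d-1) / (d-1)! = sum_(k >= 2) (-1)^k x^k / (k (k-1))
    and (1 + x) log (1 + x) = x + phi(x). The claim is thus the fixed point
    equation chi = y + kappa phi(chi). A stable graph of genus 0 is a tree whose
    vertices have genus 0, and the equation says that a rooted tree is a leaf or
    an edge leading to a root vertex that carries smaller rooted trees. Instead
    of decomposing unlabelled trees at their root, the proof computes both
    sides coefficient by coefficient.

    - By orbit counting, dividing by |Aut| amounts to labelling the vertices and
      the half-edges and dividing by the number of labellings. This turns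
      chi_refined 0 n into a sum over labelled trees with k + 1 vertices and
      n + 2k half-edges ([weight_labels], [chi_refined0]).

    - If the half-edges are distributed among the vertices with valences d_v,
      there are (prod_v d_v) (n + k - 1)! / n! ways to pair some of them off
      into a tree ([card_trees]). The proof is an induction on k by contracting
      an edge in all possible ways.

    - The count depends only on the valences, so the sum over distributions is a
      coefficient of a power of a single exponential generating series, namely
      x phi(x) ([sum_prod_fibers], [sum_lgraph_weight]). Hence for N >= 1 the
      coefficient of kappa^N y^m in chi is (m+N-1)! / (m! N!) times that of x^(m+N-1) in
      phi^N.

    - By Lagrange inversion ([lagrange_inversion]) these are also the
      coefficients of the solution f of f = y + kappa phi(f). Inversion is
      proved here for a polynomial phi divisible by x^2, which is enough because
      a given coefficient of chi only involves a truncation of phi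
      ([chi_series_fixed]). *)

(** * Counting trees on a fixed set of half-edges *)

Section Trees.
Variables (T V : finType).
Implicit Types (att : T -> V) (A : {set T}) (W : {set V}) (f : {perm T}).

Definition moved f : {set T} := [set h | f h != h].

(** Connectedness, encoded by two-colourings of the vertices instead of paths:
    when two vertices are merged, colourings are simply pulled back. *)
Definition joined att W f : bool :=
  [forall c : {ffun V -> bool}, [forall h, c (att (f h)) == c (att h)] ==>
    [forall u in W, forall v in W, c u == c v]].

Lemma joinedP att W f :
  reflect (forall c : V -> bool, (forall h, c (att (f h)) = c (att h)) ->
             {in W &, forall u v, c u = c v})
          (joined att W f).
Proof.
apply: (iffP forallP) => [J c cf u v uW vW|J c].
  have cf' : [forall h, [ffun x => c x] (att (f h)) == [ffun x => c x] (att h)].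
    by apply/forallP=> h; rewrite !ffunE cf.
  have /implyP/(_ cf')/forall_inP/(_ u uW)/forall_inP/(_ v vW) := J [ffun x => c x].
  by rewrite !ffunE => /eqP.
apply/implyP=> /forallP cf; apply/forall_inP=> u uW; apply/forall_inP=> v vW.
by apply/eqP; apply: J => // h; apply/eqP.
Qed.

Definition merge (u v x : V) : V := if x == v then u else x.

(** For an involution f exchanging h and h', composing with the transposition
    makes both of them fixed points. Together with the identification of their
    two end vertices by [merge], this contracts the edge. *)
Definition cut_edge (h h' : T) f : {perm T} := (tperm h h' * f)%g.

Lemma cut_edgeE h h' f : f h = h' -> involutive f ->
  forall x, cut_edge h h' f x = if (x == h) || (x == h') then x else f x.
Proof.
move=> fh fK x; rewrite /cut_edge permM.
by case: tpermP => [->|->|/eqP/negPf-> /eqP/negPf->];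
  rewrite ?eqxx ?orbT // -fh fK.
Qed.

Lemma cut_edge_invol h h' f : f h = h' -> involutive f ->
  involutive (cut_edge h h' f).
Proof.
move=> fh fK x; have E := cut_edgeE fh fK; rewrite !E.
case xhh': ((x == h) || (x == h')); first by rewrite xhh'.
have -> : (f x == h) || (f x == h') = false; last exact: fK.
by rewrite -xhh' -fh (inj_eq perm_inj) orbC -(fK h) !(inj_eq perm_inj) fK.
Qed.

Lemma moved_cut_edge h h' f : f h = h' -> involutive f ->
  moved (cut_edge h h' f) = moved f :\: [set h; h'].
Proof.
move=> fh fK; apply/setP=> x; rewrite !inE (cut_edgeE fh fK).
by case: ifP => //; rewrite eqxx.
Qed.

Lemma card_moved_cut_edge h h' f : f h = h' -> h != h' -> involutive f ->
  #|moved f| = (#|moved (cut_edge h h' f)| + 2)%N.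
Proof.
move=> fh hh' fK; rewrite (moved_cut_edge fh fK) cardsD.
have sub : [set h; h'] \subset moved f.
  by apply/subsetP=> x; rewrite !inE => /orP[]/eqP->; rewrite -?fh ?fK ?fh // eq_sym.
rewrite (setIidPr sub) cards2 hh' subnK //.
by rewrite -[X in (X <= _)%N]/(true.+1) -hh' -cards2 subset_leq_card.
Qed.

Lemma merge_att att W u v : u \in W -> u != v -> (forall h, att h \in W) ->
  forall h, (merge u v \o att) h \in W :\ v.
Proof.
move=> uW uv attW h; rewrite /= /merge in_setD1.
by case: (eqVneq (att h) v) => [_|->]; rewrite ?uv ?attW.
Qed.

(** The colourings constant along the edge are exactly those that factor
    through the contraction, so contracting preserves connectedness. *)
Lemma joined_contract att W f h h' : f h = h' -> involutive f ->
  att h \in W -> att h != att h' ->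
  joined (merge (att h) (att h') \o att) (W :\ att h') (cut_edge h h' f) =
  joined att W f.
Proof.
move=> fh fK uW uv; have E := cut_edgeE fh fK.
have fh' : f h' = h by rewrite -fh fK.
apply/joinedP/joinedP => J c cf.
  have cuv : c (att h') = c (att h) by rewrite -(cf h) fh.
  have cm x : c (merge (att h) (att h') x) = c x.
    by rewrite /merge; case: eqP => // ->.
  have cu w : w \in W -> c w = c (att h).
    move=> wW; case: (eqVneq w (att h')) => [->//|wv].
    apply: (J c) => [x||]; rewrite ?in_setD1 ?wv ?uv //=.
    by rewrite !cm E; case: ifP => // _; apply: cf.
  by move=> w w' /cu -> /cu ->.
have K := J (c \o merge (att h) (att h')).
move=> w w' /setD1P[wv wW] /setD1P[w'v w'W].
have := K _ w w' wW w'W; rewrite /merge /= (negPf wv) (negPf w'v); apply.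
move=> x; case: (eqVneq x h) => [->|xh].
  by rewrite fh eqxx /= (negPf uv).
case: (eqVneq x h') => [->|xh']; first by rewrite fh' eqxx /= (negPf uv).
by have := cf x; rewrite /= E (negPf xh) (negPf xh').
Qed.

(** A connected graph has at least one edge less than it has vertices. If there
    are two vertices, some edge is not a loop, since otherwise the indicator of
    a single vertex would be an invariant colouring; contract that edge. *)
Lemma edge_bound att W f : (forall h, att h \in W) ->
  involutive f -> joined att W f -> (#|W|.-1.*2 <= #|moved f|)%N.
Proof.
have [n] := ubnP #|W|; elim: n => // n IHn in att W f *.
rewrite ltnS => leWn attW fK J.
case: (ltnP 1 #|W|) => [W1|]; last by case: #|W| => [|[]].
have [h uv] : exists h, att h != att (f h).
  have [/existsP[h uv]|/existsPn none] :=
    boolP [exists h, att h != att (f h)]; first by exists h.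
  have [w wW] : exists w, w \in W by apply/set0Pn; rewrite -card_gt0 ltnW.
  have [w' /setD1P[w'w w'W]] : exists w', w' \in W :\ w.
    by apply/set0Pn; rewrite -card_gt0; move: W1; rewrite (cardsD1 w) wW.
  have /joinedP/(_ (fun x => x == w)) := J.
  have inv h : (att (f h) == w) = (att h == w) by have /negbNE/eqP<- := none h.
  by move=> /(_ inv w w' wW w'W); rewrite eqxx (negPf w'w).
have hh' : h != f h by apply: contraNneq uv => <-.
rewrite (card_moved_cut_edge (erefl _) hh' fK).
rewrite -(joined_contract (erefl (f h)) fK (attW h) uv) in J.
have cardW := cardsD1 (att (f h)) W; rewrite attW add1n in cardW.
apply: leq_trans (_ : (#|W :\ att (f h)|.-1.*2 + 2 <= _)%N).
  by rewrite cardW /=; case: #|_| => // m; rewrite doubleS addn2.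
rewrite leq_add2r; apply: (IHn (merge (att h) (att (f h)) \o att)) J.
- by rewrite -ltnS -cardW.
- by apply: merge_att.
- exact: cut_edge_invol.
Qed.

Definition valency att A v : nat := #|[set h in A | att h == v]|.

(** Here A is the set of half-edges still present and W the set of vertices
    still present after some contractions. A tree is a connected graph with
    |W| - 1 edges, hence with 2 (|W| - 1) half-edges moved by f. *)
Definition trees att A W : {set {perm T}} :=
  [set f : {perm T} | [&& [forall h, f (f h) == h], moved f \subset A,
     joined att W f & #|moved f| == #|W|.-1.*2]].

Lemma treesP att A W f : reflect
  [/\ involutive f, moved f \subset A, joined att W f & #|moved f| = #|W|.-1.*2]
  (f \in trees att A W).
Proof.
rewrite inE; apply: (iffP and4P) => [] [fK fA fW /eqP fn]; split=> //.
- by move=> h; apply/eqP/(forallP fK).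
- by apply/forallP => h; rewrite fK.
Qed.

(** Removing a loop would leave a connected graph with too few edges. *)
Lemma tree_no_loop att A W f h : (forall h, att h \in W) ->
  f \in trees att A W -> h \in moved f -> att h != att (f h).
Proof.
move=> attW /treesP[fK _ fJ cardf]; rewrite inE eq_sym => hf.
apply/eqP => attE; have E := cut_edgeE (erefl (f h)) fK.
have := @edge_bound att W _ attW (cut_edge_invol (erefl (f h)) fK).
rewrite -cardf (card_moved_cut_edge (erefl (f h)) hf fK) leqNgt addn2 ltnS leqnSn.
suff J : joined att W (cut_edge h (f h) f) by move/(_ J).
apply/joinedP => c cf; have /joinedP := fJ; apply => x.
have := cf x; rewrite E.
by case: (eqVneq x h) => [->|_]; case: eqVneq => [->|_] //=; rewrite ?fK ?attE.
Qed.

Lemma cut_edge_inj h h' : injective (cut_edge h h').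
Proof. exact: mulgI. Qed.

(** Contraction is a bijection from the trees in which h and h' form an edge to
    the trees on the contracted data, the inverse being the same composition
    with a transposition. *)
Lemma card_trees_contract att A W h h' :
  (forall h, att h \in W) -> h \in A -> h' \in A -> att h != att h' ->
  #|[set f in trees att A W | f h == h']| =
  #|trees (merge (att h) (att h') \o att) (A :\: [set h; h']) (W :\ att h')|.
Proof.
move=> attW hA h'A uv; rewrite -[LHS](card_imset _ (@cut_edge_inj h h')).
have hh' : h != h' by apply: contraNneq uv => <-.
have cardW := cardsD1 (att h') W; rewrite attW add1n in cardW.
have cardW1 : (0 < #|W :\ att h'|)%N.
  by rewrite card_gt0; apply/set0Pn; exists (att h); rewrite in_setD1 uv attW.
congr #|pred_of_set _|; apply/setP=> g; apply/imsetP/idP => [[f] | gT].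
  rewrite inE => /andP[/treesP[fK fA fJ cardf] /eqP fh] ->.
  apply/treesP; split; first exact: cut_edge_invol.
  - by rewrite moved_cut_edge // setSD.
  - by rewrite joined_contract.
  - have := card_moved_cut_edge fh hh' fK; rewrite cardf cardW.
    by case: #|_ :\ _| cardW1 => //= m _; rewrite doubleS addn2 => -[].
have /treesP[gK gA gJ cardg] := gT.
have gh x : x \in [set h; h'] -> g x = x.
  move=> xh; apply/eqP; rewrite -[_ == _]negbK; apply: contraL xh => xg.
  have {}xg : x \in moved g by rewrite inE.
  by have /setDP[] := subsetP gA x xg.
have {}gh : (g h = h) * (g h' = h') by split; apply: gh; rewrite !inE eqxx ?orbT.
pose f := cut_edge h h' g.
have fE x : f x = if x == h then h' else if x == h' then h else g x.
  rewrite /f /cut_edge permM; case: tpermP => [->|->|/eqP/negPf-> /eqP/negPf->//].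
    by rewrite eqxx gh.
  by rewrite eqxx gh eq_sym (negPf hh').
have fh : f h = h' by rewrite fE eqxx.
have fK : involutive f.
  move=> x; rewrite !fE.
  case: (eqVneq x h) => [->|xh]; first by rewrite eqxx eq_sym (negPf hh').
  case: (eqVneq x h') => [->|xh']; first by rewrite eqxx.
  have -> : (g x == h) = false by rewrite -{1}gh.1 (inj_eq perm_inj) (negPf xh).
  have -> : (g x == h') = false by rewrite -{1}gh.2 (inj_eq perm_inj) (negPf xh').
  exact: gK.
have gE : g = cut_edge h h' f by rewrite /f /cut_edge mulgA tperm2 mul1g.
exists f => //; rewrite inE fh eqxx andbT; apply/treesP; split=> //.
- apply/subsetP=> x xf; have [|xhh'] := boolP (x \in [set h; h']).
    by rewrite !inE => /orP[]/eqP->.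
  have xg : x \in moved g by rewrite gE moved_cut_edge // in_setD xhh'.
  by have /setDP[] := subsetP gA x xg.
- by rewrite -(joined_contract fh fK (attW _) uv) -gE.
- rewrite (card_moved_cut_edge fh hh' fK) -gE cardg cardW.
  by case: #|_ :\ _| cardW1 => //= m _; rewrite doubleS addn2.
Qed.

Lemma valency_contract att A h h' w :
  h \in A -> h' \in A -> att h != att h' -> w != att h' -> w != att h ->
  valency (merge (att h) (att h') \o att) (A :\: [set h; h']) w =
  valency att A w.
Proof.
move=> hA h'A uv wv wu; apply: eq_card => x; rewrite !inE /= /merge.
case: (eqVneq (att x) (att h')) => [->|xv].
  by rewrite [att h == _]eq_sym (negPf wu) [att h' == _]eq_sym (negPf wv) !andbF.
have -> : (x == h') = false by apply: contraNF xv => /eqP->.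
case: (eqVneq x h) => [->|] /=; last by [].
by rewrite [att h == _]eq_sym (negPf wu) andbF.
Qed.

(** The two half-edges of the contracted edge disappear from the vertex that
    results from merging its end points. *)
Lemma valency_contract_eq att A h h' :
  h \in A -> h' \in A -> att h != att h' ->
  (valency (merge (att h) (att h') \o att) (A :\: [set h; h']) (att h) + 2 =
   valency att A (att h) + valency att A (att h'))%N.
Proof.
move=> hA h'A uv; rewrite /valency -cardsUI.
set U := [set x in A | att x == att h]; set U' := [set x in A | att x == att h'].
have -> : U :&: U' = set0.
  apply/setP=> x; rewrite !inE; case: (eqVneq (att x) (att h)) => [->|]; rewrite ?andbF //.
  by rewrite (negPf uv) !andbF.
have hh' : h' != h by apply: contraNneq uv => <-.
rewrite cards0 addn0 (cardsD1 h (U :|: _)) (cardsD1 h' (_ :\ h)) !inE hA h'A !eqxx hh' orbT.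
rewrite !add1n addn2; congr _.+2; apply: eq_card => x; rewrite !inE /= /merge.
rewrite negb_or -!andbA andbCA -andb_orr; congr [&& _, _, _ & _].
by case: (eqVneq (att x) (att h')); rewrite ?eqxx ?orbT ?orbF.
Qed.

Lemma sum_valency (R : pzSemiRingType) att A W (F : V -> R) :
  (forall h, att h \in W) ->
  \sum_(h in A) F (att h) = \sum_(v in W) (valency att A v)%:R * F v.
Proof.
move=> attW; rewrite (partition_big att (mem W)) //=; apply: eq_bigr => v vW.
rewrite (eq_bigr (fun=> F v)) => [|h /andP[_ /eqP->]//].
rewrite sumr_const mulr_natl; congr (_ *+ _).
by apply: eq_card => h; rewrite !inE.
Qed.

(** Double counting of the pairs formed by a tree and one of its k edges, each
    edge being counted once for either orientation. *)
Lemma sum_card_moved att A W k : (forall h, att h \in W) -> #|W| = k.+1 ->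
  (#|trees att A W| * k.*2 =
   \sum_(h in A) \sum_(h' in A | att h != att h')
     #|[set f in trees att A W | f h == h']|)%N.
Proof.
move=> attW cardW.
transitivity (\sum_(f in trees att A W) \sum_(h in A)
    \sum_(h' in A | att h != att h') (f h == h'))%N; last first.
  rewrite exchange_big; apply: eq_bigr => h hA.
  rewrite exchange_big; apply: eq_bigr => h' _.
  by rewrite -sum1_card -big_mkcondr; apply: eq_bigl => f; rewrite !inE.
rewrite -sum_nat_const; apply: eq_bigr => f fT.
have /treesP[fK fA fJ cardf] := fT; rewrite -[k]/(k.+1.-1) -cardW -cardf -sum1_card.
rewrite [LHS](eq_bigl (fun h => (h \in A) && (h \in moved f))); last first.
  by move=> h /=; case hf: (h \in moved f); rewrite ?andbF // (subsetP fA).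
rewrite big_mkcondr; apply: eq_bigr => h hA; case: ifPn => hf.
  have uv := tree_no_loop attW fT hf.
  have fhA : f h \in A.
    by apply: (subsetP fA); move: hf; rewrite !inE fK eq_sym.
  rewrite (bigD1 (f h)) /= ?fhA // eqxx big1 // => h' /andP[_].
  by rewrite eq_sym => /negPf->.
rewrite big1 // => h' /andP[_ uv]; move: hf; rewrite inE negbK => /eqP->.
by have /negPf-> : h != h' by apply: contraNneq uv => ->.
Qed.

(** Induction on the number k of edges. Write d_v for the valences and P for
    their product. By double counting and contraction, 2 (k+1) times the number
    of trees with k + 1 edges is the sum over pairs u != v of vertices of
    d_u d_v times the number of trees with k edges on the contracted data; there
    d_u and d_v are replaced by d_u + d_v - 2. So the sum is proportional to
    P * sum_(u != v) (d_u + d_v - 2), and the last factor depends on the d_v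
    only through their sum n + 2 (k+1). The lower bound on the valences
    is preserved by contraction and excludes the empty vertex, for which the
    formula would read 0 instead of 1. *)
Lemma card_trees (R : numFieldType) att A W k n :
  (forall h, att h \in W) -> #|W| = k.+1 -> #|A| = (n + k.*2)%N ->
  {in W, forall v, 1 < valency att A v}%N ->
  #|trees att A W|%:R =
    \prod_(v in W) (valency att A v)%:R * (n + k).-1`!%:R / n`!%:R :> R.
Proof.
elim: k => [|k IHk] in att A W n * => attW cardW cardA val2.
  have /cards1P[w Ww] : #|W| == 1%N by rewrite cardW.
  have attw h : att h = w by apply/set1P; rewrite -Ww.
  have valw : valency att A w = n.
    rewrite -[n]addn0 -cardA; apply: eq_card => h; rewrite inE attw eqxx andbT.
    by [].
  have n0 : (0 < n)%N by rewrite -valw ltnW // val2 // Ww set11.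
  rewrite Ww big_set1 valw addn0.
  have -> : trees att A [set w] = [set (1%g : {perm T})].
    apply/setP=> f; rewrite in_set1; apply/treesP/eqP => [[_ _ _]|->].
      rewrite cards1 => /eqP; rewrite cards_eq0 => /eqP f0; apply/permP => h.
      rewrite perm1; apply/eqP; have := in_set0 h; rewrite -f0 inE.
      by move/negbFE.
    have m0 : moved (1%g : {perm T}) = set0.
      by apply/setP => h; rewrite !inE perm1 eqxx.
    split; rewrite ?m0 ?cards0 ?cards1 ?sub0set //; first by move=> h; rewrite !perm1.
    by apply/joinedP=> c _ u v /set1P-> /set1P->.
  case: n n0 {valw cardA} => // n _; rewrite cards1 factS natrM mulfV //.
  by rewrite mulf_eq0 !pnatr_eq0 -lt0n fact_gt0.
pose d v : R := (valency att A v)%:R.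
have d0 v : v \in W -> d v != 0.
  by move=> /val2 v2; rewrite pnatr_eq0 -lt0n ltnW.
pose P := \prod_(v in W) d v.
pose c : R := (n + k).-1`!%:R / n`!%:R.
have cardA' : \sum_(v in W) d v = (n + k.+1.*2)%:R.
  transitivity (\sum_(v in W) d v * 1 : R); first by apply: eq_bigr => v _; rewrite mulr1.
  by rewrite -(sum_valency A (fun=> 1) attW) sumr_const cardA.
have nk : (0 < n + k)%N.
  have : #|W|%:R * 2 <= (n + k.+1.*2)%:R :> R.
    rewrite -cardA' mulr_natl -sumr_const; apply: ler_sum => v vW.
    by rewrite (ler_nat R 2) val2.
  by rewrite -natrM ler_nat cardW; lia.
have term h h' : h \in A -> h' \in A -> att h != att h' ->
  #|[set f in trees att A W | f h == h']|%:R =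
  P * c / (d (att h) * d (att h')) * (d (att h) + d (att h') - 2).
  move=> hA h'A uv; rewrite card_trees_contract //.
  set att' := merge _ _ \o att; set A' := A :\: _; set W' := W :\ _.
  have valu : (valency att' A' (att h))%:R = d (att h) + d (att h') - 2.
    apply: (addIr 2); rewrite subrK -!natrD.
    by have := valency_contract_eq hA h'A uv => <-.
  have cardW' : #|W'| = k.+1.
    by have := cardsD1 (att h') W; rewrite attW cardW => -[].
  rewrite (IHk att' A' W' n (merge_att (attW h) uv attW)) //.
  - rewrite (bigD1 (att h)) /=; last by rewrite !inE uv attW.
    rewrite valu /P [\prod_(v in W) _](bigD1 (att h)) //=.
    rewrite [\prod_(v in W | v != att h) _](bigD1 (att h')) /=; last by rewrite attW eq_sym.
    rewrite (eq_bigl (fun i => [&& i \in W, i != att h & i != att h'])) => [|i]; last first.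
      by rewrite !inE -andbA andbCA; congr (_ && _); rewrite andbC.
    rewrite (eq_bigr d) => [|w /and3P[_ wu wv]]; last by rewrite valency_contract.
    rewrite (eq_bigl (fun i => [&& i \in W, i != att h & i != att h'])) => [|i]; last first.
      by rewrite -andbA.
    rewrite /c; set Q := \prod_(i in W | _) _.
    by field; rewrite !d0 // pnatr_eq0 -lt0n fact_gt0.
  - have hh' : h != h' by apply: contraNneq uv => ->.
    have sub : [set h; h'] \subset A by apply/subsetP => x /set2P[] ->.
    rewrite cardsD (setIidPr sub) cards2 hh' cardA doubleS !addnS; lia.
  - move=> w /setD1P[wv wW]; case: (eqVneq w (att h)) => [->|wu]; last first.
      by rewrite valency_contract // val2.
    have := valency_contract_eq hA h'A uv; have := val2 _ (attW h); have := val2 _ (attW h').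
    by rewrite -/att' -/A'; lia.
pose G u v := P * c / (d u * d v) * (d u + d v - 2).
have := congr1 (fun m => m%:R : R) (sum_card_moved A attW cardW).
rewrite /= natrM natr_sum => tE.
have {}tE : #|trees att A W|%:R * k.+1.*2%:R =
  \sum_(u in W) d u * (\sum_(v in W | u != v) d v * G u v) :> R.
  rewrite tE -(sum_valency A (fun u => \sum_(v in W | u != v) d v * G u v) attW).
  apply: eq_bigr => h hA; rewrite natr_sum [RHS]big_mkcondr /=.
  transitivity (\sum_(h' in A) if att h != att h' then G (att h) (att h') else 0).
    rewrite big_mkcondr /=; apply: eq_bigr => h' h'A; case: ifP => // uv.
    exact: term.
  rewrite (sum_valency A (fun v => if att h != v then G (att h) v else 0) attW).
  by apply: eq_bigr => v _; case: ifP; rewrite ?mulr0.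
have {}tE : #|trees att A W|%:R * k.+1.*2%:R =
  P * c * (\sum_(u in W) \sum_(v in W | u != v) (d u + d v - 2)).
  rewrite tE big_distrr /=; apply: eq_bigr => u uW.
  rewrite !big_distrr /=; apply: eq_bigr => v /andP[vW _].
  by rewrite /G; field; rewrite !d0.
(* Adding the term v = u, which is (d u - 2) + d u, makes the inner sum
   complete; it is then subtracted again in closed form. *)
have sumE : \sum_(u in W) \sum_(v in W | u != v) (d u + d v - 2) =
   k.+1.*2%:R * (n + k)%:R.
  transitivity (\sum_(u in W) ((k.+1%:R * (d u - 2) + \sum_(v in W) d v) - d u)).
    apply: eq_bigr => u uW.
    rewrite (eq_bigr (fun v => (d u - 2) + d v)) => [|v _]; last by rewrite addrAC.
    rewrite big_split /= sumr_const [in RHS](bigD1 u) //= -mulr_natl.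
    rewrite (eq_bigl (fun v => (v \in W) && (v != u))) => [|v]; last by rewrite eq_sym.
    rewrite (_ : #|_| = k.+1); last first.
      have := cardsD1 u W; rewrite uW cardW => -[->]; apply: eq_card => v.
      by rewrite !inE eq_sym andbC.
    by rewrite addrC [RHS]addrC addrA [RHS]addrAC; ring.
  rewrite sumrB big_split /= -big_distrr /= sumrB !sumr_const cardA' cardW.
  by rewrite -!muln2; ring.
have k2 : k.+1.*2%:R != 0 :> R by rewrite pnatr_eq0.
apply: (mulIf k2); rewrite tE sumE -/P /c addnS /=.
rewrite -(prednK nk) factS natrM (prednK nk).
by field; rewrite pnatr_eq0 -lt0n fact_gt0.
Qed.
End Trees.

(** * Sums over distributions of half-edges *)

Lemma deriv_prod_fin (R : comNzRingType) (V : finType) (p : V -> {poly R}) :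
  (\prod_v p v)^`() = \sum_u \prod_v (if v == u then (p v)^`() else p v).
Proof.
suff E (s : seq V) : uniq s -> (\prod_(v <- s) p v)^`() =
    \sum_(u <- s) \prod_(v <- s) (if v == u then (p v)^`() else p v).
  by rewrite E // index_enum_uniq.
elim: s => [|w s IHs] /=; first by rewrite !big_nil derivC.
case/andP=> ws us; rewrite !big_cons derivM IHs // eqxx; congr (_ * _ + _).
  by apply: eq_big_seq => v vs; case: eqP vs ws => // -> ->.
rewrite big_distrr; apply: eq_big_seq => v vs; rewrite big_cons.
by case: eqP vs ws => // -> ->.
Qed.

Lemma sum_ffun_recl (R : nmodType) (V : finType) n (F : {ffun 'I_n.+1 -> V} -> R) :
  \sum_a F a = \sum_u \sum_(a : {ffun 'I_n -> V})
     F [ffun i => if unlift ord0 i is Some j then a j else u].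
Proof.
rewrite pair_big /=.
pose cns (x : V * {ffun 'I_n -> V}) : {ffun 'I_n.+1 -> V} :=
  [ffun i => if unlift ord0 i is Some j then x.2 j else x.1].
rewrite (reindex cns) //=.
exists (fun a : {ffun 'I_n.+1 -> V} => (a ord0, [ffun i => a (lift ord0 i)])).
  move=> [u a] _; rewrite /cns !ffunE unlift_none; congr (_, _).
  by apply/ffunP=> i; rewrite !ffunE liftK.
by move=> a _; apply/ffunP=> i; rewrite !ffunE /=; case: unliftP => [j|] ->; rewrite ?ffunE.
Qed.

(** The product formula for exponential generating functions: p v is the
    generating function of a weight on finite sets, its coefficients being
    multiplied by factorials. Letting the first element of the domain go to u
    shifts the weight at u, which is differentiation of p u; so the induction on
    n is the Leibniz rule for the product. *)
Lemma sum_prod_fibers (R : comNzRingType) (V : finType) n (p : V -> {poly R}) :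
  \sum_(a : {ffun 'I_n -> V}) \prod_v
     (let d := #|[set h | a h == v]| in (p v)`_d *+ d`!) =
  (\prod_v p v)`_n *+ n`!.
Proof.
elim: n => [|n IHn] in p *.
  rewrite (big_pred1 (ffun0 (card_ord 0))).
    rewrite coef0_prod; apply: eq_bigr => v _.
    by rewrite eq_card0 // => -[].
  by move=> a; symmetry; apply/eqP/ffunP => -[].
rewrite sum_ffun_recl.
pose q u v := if v == u then (p v)^`() else p v.
transitivity (\sum_u (\prod_v q u v)`_n *+ n`!).
  apply: eq_bigr => u _; rewrite -IHn; apply: eq_bigr => a _; apply: eq_bigr => v _.
  have -> : #|[set h | [ffun i => if unlift ord0 i is Some j then a j else u] h == v]| =
    ((v == u) + #|[set h | a h == v]|)%N.
    rewrite (cardsD1 ord0) inE ffunE unlift_none eq_sym; congr (_ + _)%N.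
    rewrite -[RHS](card_imset _ (@lift_inj _ ord0)); congr #|pred_of_set _|.
    apply/setP=> i; rewrite !inE ffunE; case: unliftP => [j|] ->.
      by rewrite mem_imset ?inE //; exact: lift_inj.
    rewrite eqxx; symmetry; apply/imsetP=> -[j _ /eqP]; by rewrite (negPf (neq_lift _ _)).
  by rewrite /q; case: eqP => _ //=; rewrite add1n coef_deriv -mulrnA factS.
by rewrite sumrMnl -coef_sum -deriv_prod_fin coef_deriv -mulrnA factS.
Qed.

(** * Stable graphs of genus 0 *)

Definition flip_perm (G : stable_graph) : {perm 'I_(nhalf G)} :=
  perm (inv_inj (@flipK G)).

Lemma flip_permE G h : flip_perm G h = flip h. Proof. exact: permE. Qed.

Lemma flip_permK G : involutive (flip_perm G).
Proof. by move=> h; rewrite !flip_permE flipK. Qed.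

Lemma card_int_edges G : (#|int_edges G|.*2 = #|moved (flip_perm G)|)%N.
Proof.
pose edge (h : 'I_(nhalf G)) := [set h; flip h].
rewrite -muln2 -sum_nat_const -sum1_card.
rewrite [RHS](partition_big edge (fun e => e \in int_edges G)) /=; last first.
  by move=> h; rewrite inE flip_permE => hf; apply: imset_f; rewrite inE.
apply: eq_bigr => _ /imsetP[h hf ->]; rewrite inE in hf.
have <- : #|edge h| = 2%N by rewrite cards2 eq_sym hf.
rewrite -sum1_card; apply: eq_bigl => h'.
rewrite [h' \in moved _]inE flip_permE.
apply/idP/andP=> [/set2P[]->|[_ /eqP E]]; last first.
  by have := set21 h' (flip h'); rewrite -/(edge h') E.
  by rewrite flipK eq_sym hf /edge flipK setUC.
by rewrite hf /edge.
Qed.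

Lemma card_ext_edges G : (#|ext_edges G| + #|moved (flip_perm G)| = nhalf G)%N.
Proof.
rewrite -[RHS]card_ord -(cardsC (ext_edges G)); congr (_ + _)%N.
by apply: eq_card => h; rewrite !inE flip_permE.
Qed.

(** If there is one component, an invariant colouring is constant along paths;
    conversely the component of a vertex is itself an invariant colouring. *)
Lemma sg_connectedE G :
  sg_connected G = (0 < nvert G)%N && joined (@att G) setT (flip_perm G).
Proof.
have adj_sym : connect_sym (@adj G).
  apply: sym_connect_sym => u v; apply/existsP/existsP => -[h /andP[/eqP<- /eqP<-]];
    by exists (flip h); rewrite flipK !eqxx.
rewrite /sg_connected /ncomp; apply/eqP/andP=> [comp1|[vG /joinedP J]].
  have /card_gt0P[r /andP[r_root _]] : (0 < n_comp (@adj G) predT)%N by rewrite comp1.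
  split; first by apply: leq_ltn_trans (ltn_ord r).
  have rootE u : fingraph.root (@adj G) u = r.
    have /card_le1_eqP : (n_comp (@adj G) predT <= 1)%N by rewrite comp1.
    by apply; rewrite ?inE ?r_root //= roots_root.
  apply/joinedP=> c cf u v _ _.
  have closed_c : closed (@adj G) [pred x | c x].
    move=> x y /existsP[h /andP[/eqP<- /eqP<-]].
    by have := cf h; rewrite flip_permE !inE => ->.
  have uv : connect (@adj G) u v by rewrite -root_connect // !rootE.
  by have := closed_connect closed_c uv; rewrite !inE.
have conn u v : connect (@adj G) u v.
  suff inv h : connect (@adj G) u (att (flip_perm G h)) = connect (@adj G) u (att h).
    by rewrite -(J (connect (@adj G) u) inv u v) ?inE ?connect0.
  rewrite flip_permE.
  apply: same_connect_r => //; apply/connect1/existsP.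
  by exists (flip h); rewrite flipK !eqxx.
rewrite -(n_comp_connect adj_sym (Ordinal vG)).
by apply: eq_n_comp_r => v; rewrite inE -[RHS]/(connect _ _ _) conn.
Qed.

(** A graph whose vertices all have genus 0, on the fixed label sets 'I_N and
    'I_H: the attaching map and the flip of its half-edges. *)
Definition lgraph (N H : nat) : Type := ({ffun 'I_H -> 'I_N} * {perm 'I_H})%type.

Section Isomorphisms.
Variables N H : nat.
Implicit Types x : lgraph N H.

Definition lgraph_iso x0 x : {set {perm 'I_N} * {perm 'I_H}} :=
  [set pq : {perm 'I_N} * {perm 'I_H} | [forall h, x.1 (pq.2 h) == pq.1 (x0.1 h)] &&
            [forall h, x.2 (pq.2 h) == pq.2 (x0.2 h)]].

Lemma lgraph_isoP x0 x (pq : {perm 'I_N} * {perm 'I_H}) : reflect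
  ((forall h, x.1 (pq.2 h) = pq.1 (x0.1 h)) /\
   (forall h, x.2 (pq.2 h) = pq.2 (x0.2 h)))
  (pq \in lgraph_iso x0 x).
Proof.
rewrite inE; apply: (iffP andP) => [[/forallP a /forallP b]|[a b]].
  by split=> h; apply/eqP.
by split; apply/forallP=> h; apply/eqP.
Qed.

(** The isomorphisms between two isomorphic graphs form a torsor under the
    automorphism group. *)
Lemma card_lgraph_iso x0 x : lgraph_iso x0 x != set0 ->
  #|lgraph_iso x0 x| = #|lgraph_iso x0 x0|.
Proof.
case/set0Pn=> [[p q] /lgraph_isoP[/= pE qE]].
pose tr (rs : {perm 'I_N} * {perm 'I_H}) := (rs.1 * p, rs.2 * q)%g.
have tr_inj : injective tr by move=> [r s] [r' s'] [/mulIg-> /mulIg->].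
rewrite -[RHS](card_imset _ tr_inj); congr #|pred_of_set _|.
apply/setP=> -[r s]; apply/lgraph_isoP/imsetP => /= [[rE sE]|[[r' s'] /lgraph_isoP/= [rE sE] [-> ->]]].
  exists (r * p^-1, s * q^-1)%g; last by rewrite /tr /= !mulgVK.
  apply/lgraph_isoP; split=> h /=; rewrite !permM.
    by apply: (@perm_inj _ p); rewrite -pE !permKV rE.
  by apply: (@perm_inj _ q); rewrite -qE !permKV sE.
by split=> h; rewrite !permM ?pE ?rE ?qE ?sE.
Qed.

(** Orbit-stabilizer for relabelling: every pair of permutations of the labels
    is an isomorphism from x0 onto exactly one labelled graph. *)
Lemma card_lgraph_orbit x0 :
  (#|[set x | lgraph_iso x0 x != set0]| * #|lgraph_iso x0 x0| = N`! * H`!)%N.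
Proof.
pose act (pq : {perm 'I_N} * {perm 'I_H}) : lgraph N H :=
  ([ffun h => pq.1 (x0.1 (pq.2^-1 h)%g)], (pq.2^-1 * x0.2 * pq.2)%g).
have actE pq x : (act pq == x) = (pq \in lgraph_iso x0 x).
  apply/eqP/lgraph_isoP => [<-|[pE qE]].
    by split=> h; rewrite /= ?ffunE ?permM permK.
  case: x pE qE => f g /= pE qE; congr (_, _).
    by apply/ffunP=> h; rewrite ffunE -pE permKV.
  by apply/permP=> h; rewrite !permM -qE permKV.
have <- : #|{: {perm 'I_N} * {perm 'I_H}}| = (N`! * H`!)%N.
  by rewrite card_prod !card_Sn.
rewrite -[RHS]sum1_card (partition_big act (fun x => x \in [set x | lgraph_iso x0 x != set0])) /=.
  rewrite -sum_nat_const; apply: eq_bigr => x; rewrite inE => x0x.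
  rewrite -(card_lgraph_iso x0x) -sum1_card; apply: eq_bigl => pq.
  by rewrite actE.
by move=> pq _; rewrite inE; apply/set0Pn; exists pq; rewrite -actE.
Qed.

Lemma lgraph_iso_sym x0 x pq : pq \in lgraph_iso x0 x ->
  (pq.1^-1, pq.2^-1)%g \in lgraph_iso x x0.
Proof.
case/lgraph_isoP=> pE qE; apply/lgraph_isoP; split=> h /=.
  by apply: (@perm_inj _ pq.1); rewrite -pE !permKV.
by apply: (@perm_inj _ pq.2); rewrite -qE !permKV.
Qed.

Lemma valency_iso x0 x pq v : pq \in lgraph_iso x0 x ->
  valency x.1 setT (pq.1 v) = valency x0.1 setT v.
Proof.
case/lgraph_isoP=> pE _; rewrite -[RHS](card_imset _ (@perm_inj _ pq.2)).
congr #|pred_of_set _|; apply/setP=> h; rewrite -[h](permKV pq.2).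
by rewrite mem_imset ?inE ?pE ?(inj_eq perm_inj) //; exact: perm_inj.
Qed.

Lemma card_moved_iso x0 x pq : pq \in lgraph_iso x0 x -> #|moved x.2| = #|moved x0.2|.
Proof.
case/lgraph_isoP=> _ qE; rewrite -[RHS](card_imset _ (@perm_inj _ pq.2)).
congr #|pred_of_set _|; apply/setP=> h; rewrite -[h](permKV pq.2).
by rewrite mem_imset ?inE ?qE ?(inj_eq perm_inj) //; exact: perm_inj.
Qed.

Definition stable_tree x : bool :=
  (x.2 \in trees x.1 setT setT) && [forall v, (2 < valency x.1 setT v)%N].

Lemma stable_tree_iso x0 x pq : pq \in lgraph_iso x0 x -> stable_tree x0 -> stable_tree x.
Proof.
move=> iso /andP[/treesP[fK _ fJ cardf] /forallP val].
have /lgraph_isoP[pE qE] := iso; apply/andP; split; last first.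
  by apply/forallP=> v; rewrite -[v](permKV pq.1) (valency_iso _ iso).
apply/treesP; split; last by rewrite (card_moved_iso iso).
- by move=> h; rewrite -[h](permKV pq.2) !qE fK.
- exact: subsetT.
apply/joinedP=> c cf u v _ _; have /joinedP/(_ (c \o pq.1)) J := fJ.
rewrite -[u](permKV pq.1) -[v](permKV pq.1); apply: J; rewrite ?inE // => h /=.
by rewrite -!pE -qE cf.
Qed.

End Isomorphisms.

(** For graphs G all of whose vertices have genus 0, this is an isomorphism
    between G and x. *)
Definition labels G N H (x : lgraph N H) : Prop :=
  exists (a : 'I_(nvert G) -> 'I_N) (b : 'I_(nhalf G) -> 'I_H),
    [/\ bijective a, bijective b, forall h, x.1 (b h) = a (att h)
      & forall h, x.2 (b h) = b (flip h)].

Definition labelling G : lgraph (nvert G) (nhalf G) :=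
  ([ffun h => att h], flip_perm G).

Lemma labels_labelling G : labels G (labelling G).
Proof.
exists id, id; split; [by exists id | by exists id | |] => h /=.
  by rewrite ffunE.
by rewrite flip_permE.
Qed.

Lemma bij_ord_eq m n (a : 'I_m -> 'I_n) : bijective a -> m = n.
Proof. by move/bij_eq_card; rewrite !card_ord. Qed.

Lemma labels_size G N H (x : lgraph N H) : labels G x -> nvert G = N /\ nhalf G = H.
Proof. by case=> a [b [/bij_ord_eq ? /bij_ord_eq ? _ _]]. Qed.

Lemma labelsP G (x : lgraph (nvert G) (nhalf G)) :
  reflect (labels G x) (lgraph_iso (labelling G) x != set0).
Proof.
apply: (iffP idP) => [/set0Pn[pq /lgraph_isoP[pE qE]]|[a [b [aB bB aE bE]]]]; last first.
  apply/set0Pn; exists (perm (bij_inj aB), perm (bij_inj bB)).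
  by apply/lgraph_isoP; split=> h /=; rewrite ?ffunE !permE ?flip_permE.
exists pq.1, pq.2; split=> [||h|h].
- by exists (pq.1^-1)%g; [exact: permK | exact: permKV].
- by exists (pq.2^-1)%g; [exact: permK | exact: permKV].
- by rewrite pE ffunE.
- by rewrite qE flip_permE.
Qed.

Lemma sg_aut_labelling G : (forall v, @vgenus G v = 0%N) ->
  sg_aut G = lgraph_iso (labelling G) (labelling G).
Proof.
move=> g0; apply/setP=> pq; rewrite !inE; have -> : [forall v, @vgenus G (pq.1 v) == vgenus v].
  by apply/forallP=> v; rewrite !g0.
rewrite andbT; congr (_ && _); apply: eq_forallb => h; rewrite ?ffunE //.
by rewrite !flip_permE.
Qed.

(** The summand of [chi_refined]. *)
Definition weight G : {poly rat} :=
  ((\prod_(v < nvert G) chi_M (vgenus v) (valence v)) / #|sg_aut G|%:R)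
      *: 'X^#|int_edges G|.

Definition lgraph_weight N H (x : lgraph N H) : rat :=
  \prod_v chi_M 0 (valency x.1 setT v).

(** All labellings of G have the same weight and there are N! H! / |Aut G| of
    them, so the division by |Aut G| becomes a division by N! H!. The labelled
    graph x0 is a witness that G is a tree, which is invariant under
    relabelling. *)
Lemma weight_labels G N H (x0 : lgraph N H) : (forall v, @vgenus G v = 0%N) ->
  stable_tree x0 -> labels G x0 ->
  weight G = \sum_(x : lgraph N H | stable_tree x && `[< labels G x >])
    (lgraph_weight x / (N`! * H`!)%:R) *: 'X^(N.-1).
Proof.
move=> g0 x0T Gx0; have [NE HE] := labels_size Gx0; subst N H.
have /set0Pn[pq iso0] := introT (labelsP x0) Gx0.
have aut0 : (0 < #|sg_aut G|)%N.
  rewrite sg_aut_labelling // card_gt0; apply/set0Pn; exists (1%g, 1%g).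
  by apply/lgraph_isoP; split=> h; rewrite !perm1.
have wE : \prod_(v < nvert G) chi_M (vgenus v) (valence v) = lgraph_weight (labelling G).
  apply: eq_bigr => v _; rewrite g0; congr chi_M; apply: eq_card => h.
  by rewrite !inE ffunE.
have edgesE : #|int_edges G| = (nvert G).-1.
  apply: double_inj; rewrite card_int_edges -[flip_perm G]/((labelling G).2).
  rewrite -(card_moved_iso iso0); have /andP[/treesP[_ _ _ ->] _] := x0T.
  by rewrite cardsT card_ord.
have xT (x : lgraph (nvert G) (nhalf G)) : labels G x -> stable_tree x.
  move=> /(introT (labelsP x))/set0Pn[rs iso]; apply: stable_tree_iso iso _.
  exact: stable_tree_iso (lgraph_iso_sym iso0) x0T.
pose X := [set x | lgraph_iso (labelling G) x != set0].
rewrite /weight wE edgesE (eq_bigl (fun x => x \in X)); last first.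
  move=> x; rewrite inE; apply/andP/idP => [[_ /asboolP/(introT (labelsP x))]//|xX].
  by have /labelsP Gx := xX; split; [apply: xT | apply/asboolP].
rewrite (eq_bigr (fun=> (lgraph_weight (labelling G) /
    ((nvert G)`! * (nhalf G)`!)%:R) *: 'X^((nvert G).-1))).
  rewrite sumr_const -(card_lgraph_orbit (labelling G)) -sg_aut_labelling //.
  rewrite scalerMnl; congr (_ *: _); rewrite natrM -mulr_natr.
  have orb0 : (0 < #|X|)%N.
    by rewrite card_gt0; apply/set0Pn; exists x0; rewrite inE; apply/labelsP.
  by field; rewrite !pnatr_eq0 -!lt0n aut0 orb0.
move=> x; rewrite inE => /set0Pn[rs iso]; congr (_ / _ *: _).
rewrite /lgraph_weight (reindex_inj (@perm_inj _ rs.1)); apply: eq_bigr => v _.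
by rewrite (valency_iso _ iso).
Qed.

Lemma labels_iso G G' N H (x : lgraph N H) : sg_iso G G' -> labels G' x -> labels G x.
Proof.
case=> a [b [aB bB aE bE _]] [a' [b' [a'B b'B a'E b'E]]].
exists (a' \o a), (b' \o b); split=> [||h|h] /=; first exact: bij_comp.
- exact: bij_comp.
- by rewrite a'E aE.
- by rewrite b'E bE.
Qed.

Lemma labels_inj G G' N H (x : lgraph N H) :
  (forall v, @vgenus G v = 0%N) -> (forall v, @vgenus G' v = 0%N) ->
  labels G x -> labels G' x -> sg_iso G G'.
Proof.
move=> g0 g0' [a [b [aB bB aE bE]]] [a' [b' [[ai' a'K a'i] [bi' b'K b'i] a'E b'E]]].
exists (ai' \o a), (bi' \o b); split=> [||h|h|v] /=; rewrite ?g0 ?g0' //.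
- by apply: bij_comp aB; exists a'.
- by apply: bij_comp bB; exists b'.
- by rewrite -aE -[b h]b'i a'E !a'K b'i.
- by rewrite -bE -{2}[b h]b'i b'E b'K.
Qed.

Lemma genus0_arith (e N g m : nat) : (e.*2 = m)%N -> (N.-1.*2 <= m)%N ->
  (0 < N)%N -> e%:Z - N%:Z + 1%:Z + g%:Z = 0 -> (g = 0 /\ e = N.-1)%N.
Proof. by lia. Qed.

(** Since a connected graph has nonnegative first Betti number, total genus 0
    forces every vertex genus and the Betti number to vanish. Stability then
    gives 3 (k+1) <= n + 2k, which bounds the number of vertices. *)
Lemma genus0_labelling G n : sg_connected G -> sg_genus G = 0 ->
  #|ext_edges G| = n ->
  [/\ forall v, @vgenus G v = 0%N, stable_tree (labelling G) &
    exists2 k, (k < n)%N & nvert G = k.+1 /\ nhalf G = (n + k.*2)%N].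
Proof.
move=> Gc; have := Gc; rewrite sg_connectedE => /andP[vG J].
have bound := edge_bound (fun h => in_setT (att h)) (@flip_permK G) J.
have cE := card_int_edges G; have cX := card_ext_edges G.
have sumE : \sum_(v < nvert G) (vgenus v)%:Z = (\sum_(v < nvert G) vgenus v)%:Z.
  by rewrite (big_morph Posz PoszD (erefl _)).
rewrite cardsT card_ord in bound.
rewrite /sg_genus /betti1 (eqP Gc) sumE => gE nE.
have {sumE}[sum0 cardE] : (\sum_(v < nvert G) vgenus v = 0 /\ #|int_edges G| = (nvert G).-1)%N.
  exact: genus0_arith cE bound vG gE.
have g0 v : @vgenus G v = 0%N.
  by move/eqP: sum0; rewrite sum_nat_eq0 => /forall_inP/(_ v isT)/eqP.
have val3 v : (2 < valency (labelling G).1 setT v)%N.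
  have := @stableP G v; rewrite g0 muln0 add0n; congr (2 < _)%N.
  by apply: eq_card => h; rewrite !inE ffunE.
have tree : stable_tree (labelling G).
  apply/andP; split; last exact/forallP.
  apply/treesP; split; [exact: flip_permK | exact: subsetT | |].
    apply/joinedP=> c cf; have /joinedP/(_ c) := J; apply=> h.
    by have := cf h; rewrite !ffunE.
  by rewrite cardsT card_ord -cE cardE.
split=> //; exists (nvert G).-1; last by rewrite prednK //; split=> //; lia.
have : (3 * nvert G <= nhalf G)%N.
  rewrite -[nhalf G]card_ord -sum1_card (partition_big (@att G) xpredT) //=.
  rewrite mulnC -{1}[nvert G]card_ord -sum_nat_const; apply: leq_sum => v _.
  apply: leq_trans (val3 v) _; rewrite sum1_card.
  by apply/eq_leq/eq_card => h; rewrite !inE ffunE.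
lia.
Qed.

(** The stable graph attached to a labelled tree; its properties say that every
    labelled tree occurs among the labellings of the classes that are summed. *)
Section TreeGraph.
Variables (N H : nat) (x : lgraph N H) (xT : stable_tree x).

Fact tree_graphK : involutive x.2.
Proof. by case/andP: xT => /treesP[]. Qed.

Fact tree_graph_stable v : (2 < 2 * 0 + #|[set h | x.1 h == v]|)%N.
Proof.
have /andP[_ /forallP/(_ v)] := xT; congr (2 < _)%N.
by apply: eq_card => h; rewrite !inE.
Qed.

Definition tree_graph : stable_graph :=
  @StableGraph N H x.1 x.2 (fun=> 0%N) tree_graphK tree_graph_stable.

Lemma labels_tree_graph : labels tree_graph x.
Proof. by exists id, id; split=> //; exists id. Qed.

Lemma flip_perm_tree_graph : flip_perm tree_graph = x.2.
Proof. by apply/permP=> h; rewrite flip_permE. Qed.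

Lemma tree_graph_connected : (0 < N)%N -> sg_connected tree_graph.
Proof.
move=> N0; rewrite sg_connectedE N0 flip_perm_tree_graph.
by case/andP: xT => /treesP[].
Qed.

Lemma tree_graph_genus : (0 < N)%N -> sg_genus tree_graph = 0.
Proof.
move=> N0; rewrite /sg_genus /betti1 (eqP (tree_graph_connected N0)).
rewrite big1 // addr0 /=; have := card_int_edges tree_graph.
rewrite flip_perm_tree_graph; have /andP[/treesP[_ _ _ ->] _] := xT.
by rewrite cardsT card_ord => /double_inj->; case: N N0 => // m _; lia.
Qed.

Lemma tree_graph_ext : (#|ext_edges tree_graph| + N.-1.*2 = H)%N.
Proof.
have := card_ext_edges tree_graph; rewrite flip_perm_tree_graph.
by have /andP[/treesP[_ _ _ ->] _] := xT; rewrite cardsT card_ord.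
Qed.

End TreeGraph.

Definition genus0_class n (s : {k : 'I_n & {x : lgraph k.+1 (n + k.*2) | stable_tree x}}) :
  sg_class := \pi_sg_class%qT (tree_graph (proj2_sig (projT2 s))).

Lemma repr_iso G : sg_iso (repr (\pi_sg_class%qT G)) G.
Proof.
suff: sg_iso_equiv (repr (\pi_sg_class%qT G)) G by move/asboolP.
by apply/eqmodP; rewrite reprK.
Qed.

Lemma eq_class G G' : sg_iso G G' -> (\pi_sg_class G = \pi_sg_class G')%qT.
Proof. by move=> iso; apply/eqmodP/asboolP. Qed.

Lemma conn_classes0P n (c : sg_class) : conn_classes 0 n c ->
  (forall v, @vgenus (repr c) v = 0%N) /\
  exists2 s, c = @genus0_class n s & labels (repr c) (val (projT2 s)).
Proof.
case=> G [Gc Gg Gn] <-.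
have [g0 GT [k lt_kn [NE HE]]] := genus0_labelling Gc Gg Gn.
have [x xT Gx] : exists2 x : lgraph k.+1 (n + k.*2), stable_tree x & labels G x.
  by rewrite -NE -HE; exists (labelling G) => //; apply: labels_labelling.
split; first by have [a [b [_ _ _ _ gE]]] := repr_iso G => v; rewrite -gE g0.
exists (existT _ (Ordinal lt_kn) (exist _ x xT)); last exact: labels_iso (repr_iso _) Gx.
apply: eq_class; apply: labels_inj Gx _ => //.
exact: labels_tree_graph.
Qed.

Lemma genus0_class_conn n (s : {k : 'I_n & {x : lgraph k.+1 (n + k.*2) | stable_tree x}}) :
  conn_classes 0 n (genus0_class s).
Proof.
case: s => k [x xT]; exists (tree_graph xT) => //; split.
- exact: tree_graph_connected.
- exact: tree_graph_genus.
- by have := tree_graph_ext xT; rewrite /=; lia.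
Qed.

(** Each labelled tree is a labelling of exactly one of the isomorphism
    classes. *)
Lemma labels_class n (s : {k : 'I_n & {x : lgraph k.+1 (n + k.*2) | stable_tree x}}) c :
  conn_classes 0 n c -> labels (repr c) (val (projT2 s)) <-> c = genus0_class s.
Proof.
move=> /conn_classes0P[g0 _]; split=> [cx|->].
  rewrite -[LHS]reprK; apply: eq_class; apply: labels_inj cx _ => //.
  exact: labels_tree_graph.
exact: labels_iso (repr_iso _) (labels_tree_graph _).
Qed.

Lemma finite_conn_classes0 n : finite_set (conn_classes 0 n).
Proof.
apply: (@sub_finite_set _ _ (range (@genus0_class n))).
  by move=> c /conn_classes0P[_ [s -> _]]; exists s.
exact/finite_image/finite_finset.
Qed.

Lemma weight_class n c : conn_classes 0 n c ->
  weight (repr c) = \sum_(k < n)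
    \sum_(x : lgraph k.+1 (n + k.*2) | stable_tree x && `[< labels (repr c) x >])
      (lgraph_weight x / (k.+1`! * (n + k.*2)`!)%:R) *: 'X^k.
Proof.
case/conn_classes0P=> g0 [[k [x xT]] _ /= cx].
rewrite (weight_labels g0 xT cx) (bigD1 k) //= [X in _ + X]big1 ?addr0 // => k' k'k.
rewrite big_pred0 // => x'; apply/negP=> /andP[_ /asboolP/labels_size[NE _]].
have [NE' _] := labels_size cx.
by case/eqP: k'k; apply/val_inj; move: NE'; rewrite NE => -[].
Qed.

(** Write each weight as a sum over labellings and exchange the two sums: each
    labelled tree then contributes through the one class that it represents. *)
Lemma chi_refined0 n : chi_refined 0 n =
  \sum_(k < n) (\sum_(x : lgraph k.+1 (n + k.*2) | stable_tree x) lgraph_weight x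
     / (k.+1`! * (n + k.*2)`!)%:R) *: 'X^k.
Proof.
have [r r_uniq rP] : exists2 r : seq sg_class, uniq r & conn_classes 0 n = [set` r]%classic.
  have /finite_seqP[r ->] := finite_conn_classes0 n; exists (undup r); first exact: undup_uniq.
  by apply/seteqP; split=> c /=; rewrite mem_undup.
have memr c : (c \in r) <-> conn_classes 0 n c by rewrite rP.
rewrite /chi_refined -/(weight _) rP -fsbig_seq //.
rewrite (eq_big_seq (fun c => \sum_(k < n)
    \sum_(x : lgraph k.+1 (n + k.*2) | stable_tree x && `[< labels (repr c) x >])
      (lgraph_weight x / (k.+1`! * (n + k.*2)`!)%:R) *: 'X^k)); last first.
  by move=> c /memr; exact: weight_class.
rewrite exchange_big; apply: eq_bigr => k _; rewrite scaler_suml.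
rewrite (exchange_big_dep (fun x => stable_tree x)) => [|c x _ /andP[]//] /=.
apply: eq_bigr => x xT; rewrite xT /=.
pose s : {k : 'I_n & {x : lgraph k.+1 (n + k.*2) | stable_tree x}} :=
  existT _ k (exist _ x xT).
have sP : conn_classes 0 n (genus0_class s) by apply: genus0_class_conn.
rewrite big_mkcond (bigD1_seq (genus0_class s)) //=; last exact/memr.
rewrite asboolT; last exact/(labels_class s sP).
rewrite big_seq_cond big1 ?addr0 // => c /andP[/memr cC ne].
case: asboolP => // /(labels_class s cC) /eqP.
by rewrite (negPf ne).
Qed.

(** * Formal power series *)

Section FpsTheory.
Variable R : comNzRingType.
Implicit Types f g h : fps R.

Lemma fcoef0 n : fcoef (0 : fps R) n = 0. Proof. by []. Qed.
Lemma fcoef1 n : fcoef (1 : fps R) n = (n == 0%N)%:R. Proof. by []. Qed.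
Lemma fcoefD f g n : fcoef (f + g) n = fcoef f n + fcoef g n.
Proof. by []. Qed.
Lemma fcoefN f n : fcoef (- f) n = - fcoef f n. Proof. by []. Qed.
Lemma fcoefB f g n : fcoef (f - g) n = fcoef f n - fcoef g n.
Proof. by []. Qed.
Lemma fcoefM f g n :
  fcoef (f * g) n = \sum_(i < n.+1) fcoef f i * fcoef g (n - i).
Proof. by []. Qed.

Lemma fcoef_sum I (r : seq I) (P : pred I) (F : I -> fps R) n :
  fcoef (\sum_(i <- r | P i) F i) n = \sum_(i <- r | P i) fcoef (F i) n.
Proof. exact: (big_morph (fun f => fcoef f n) (fun f g => fcoefD f g n) (fcoef0 n)). Qed.

Lemma fcoefCM c f n : fcoef (fpsC c * f) n = c * fcoef f n.
Proof.
rewrite fcoefM big_ord_recl /= subn0 big1 ?addr0 // => i _.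
by rewrite mul0r.
Qed.

Lemma fcoefMX f n : fcoef (f * fpsX) n = if n is m.+1 then fcoef f m else 0.
Proof.
rewrite mulrC fcoefM; case: n => [|n]; first by rewrite big_ord1 mul0r.
rewrite 2!big_ord_recl /= mul0r add0r mul1r subSS subn0 big1 ?addr0 // => i _.
by rewrite mul0r.
Qed.

Fact fpsC_zmod_morphism : zmod_morphism (@fpsC R).
Proof. by move=> a b; apply: fpsP => -[|n]; rewrite fcoefB //= subr0. Qed.

Fact fpsC_monoid_morphism : monoid_morphism (@fpsC R).
Proof.
split=> [|a b]; apply: fpsP => n; first by rewrite fcoef1 /=; case: eqP.
by rewrite fcoefCM /=; case: eqP; rewrite ?mulr0.
Qed.

HB.instance Definition _ :=
  GRing.isZmodMorphism.Build R (fps R) (@fpsC R) fpsC_zmod_morphism.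
HB.instance Definition _ :=
  GRing.isMonoidMorphism.Build R (fps R) (@fpsC R) fpsC_monoid_morphism.

(** A coefficient of a product only depends on truncations of the factors; this
    transfers identities from polynomials to power series. *)
Lemma fcoefM_poly (p q : {poly R}) f g n :
  (forall i, (i <= n)%N -> p`_i = fcoef f i) ->
  (forall i, (i <= n)%N -> q`_i = fcoef g i) ->
  (p * q)`_n = fcoef (f * g) n.
Proof.
move=> pf qg; rewrite coefM fcoefM; apply: eq_bigr => i _.
by rewrite pf ?qg ?leq_subr // -ltnS.
Qed.

(** That f is divisible by y^n. *)
Definition vanish n f := forall i, (i < n)%N -> fcoef f i = 0.

Lemma vanish_all f g : (forall n, vanish n (f - g)) -> f = g.
Proof.
by move=> fg; apply: fpsP => n; apply/eqP; rewrite -subr_eq0 -fcoefB (fg n.+1).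
Qed.

Lemma vanishW m n f : (m <= n)%N -> vanish n f -> vanish m f.
Proof. by move=> mn fn i im; apply: fn; apply: leq_trans mn. Qed.

Lemma vanishD n f g : vanish n f -> vanish n g -> vanish n (f + g).
Proof. by move=> fn gn i lt_in; rewrite fcoefD fn // gn // addr0. Qed.

Lemma vanishN n f : vanish n f -> vanish n (- f).
Proof. by move=> fn i lt_in; rewrite fcoefN fn // oppr0. Qed.

Lemma vanishM m n f g : vanish m f -> vanish n g -> vanish (m + n) (f * g).
Proof.
move=> fm gn i lt_i; rewrite fcoefM big1 // => j _.
case: (ltnP j m) => [/fm->|mj]; first by rewrite mul0r.
by rewrite (gn (i - j)%N) ?mulr0 //; have := ltn_ord j; lia.
Qed.

Lemma vanishMr n f g : vanish n f -> vanish n (f * g).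
Proof. by move=> fn; rewrite -[n]addn0; apply: vanishM. Qed.

Lemma vanishX n f : vanish 1 f -> vanish n (f ^+ n).
Proof.
by move=> f1; elim: n => [|n IHn] //; rewrite exprS -add1n; apply: vanishM.
Qed.

Definition fps_deriv f : fps R := FPS (fun n => fcoef f n.+1 *+ n.+1).

Lemma fcoef_deriv f n : fcoef (fps_deriv f) n = fcoef f n.+1 *+ n.+1.
Proof. by []. Qed.

Lemma fps_derivD f g : fps_deriv (f + g) = fps_deriv f + fps_deriv g.
Proof. by apply: fpsP => n /=; rewrite mulrnDl. Qed.

Lemma fps_derivM f g : fps_deriv (f * g) = fps_deriv f * g + f * fps_deriv g.
Proof.
apply: fpsP => n; rewrite fcoefD fcoef_deriv.
pose p := fps_trunc n.+1 f; pose q := fps_trunc n.+1 g.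
have <- : (p * q)`_n.+1 = fcoef (f * g) n.+1.
  by apply: fcoefM_poly => i; apply: coef_fps_trunc.
rewrite -coef_deriv derivM coefD.
congr (_ + _); apply: fcoefM_poly => i lt_in;
  by rewrite ?coef_deriv ?coef_fps_trunc // ltnW.
Qed.

Lemma fps_derivC c : fps_deriv (fpsC c) = 0.
Proof. by apply: fpsP => n /=; rewrite mul0rn. Qed.

Lemma fps_derivX : fps_deriv fpsX = 1.
Proof. by apply: fpsP => -[|n] //=; rewrite mul0rn. Qed.

Lemma fcoef_iter_deriv k f n :
  fcoef (iter k fps_deriv f) n = fcoef f (n + k) *+ (n + k) ^_ k.
Proof.
elim: k f => [|k IHk] f; first by rewrite addn0 ffactn0.
by rewrite iterSr IHk /= -mulrnA addnS ffactSS.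
Qed.

End FpsTheory.

(** * Evaluation of polynomials in an algebra *)

Section PolyEval.
Variables (K A : comNzRingType) (c : {rmorphism K -> A}).
Implicit Types (p q : {poly K}) (f g : A).

Definition peval p f : A := (map_poly c p).[f].

Lemma peval_cons p a f : peval (p * 'X + a%:P) f = peval p f * f + c a.
Proof. by rewrite /peval rmorphD rmorphM /= map_polyX map_polyC !hornerE. Qed.

Lemma peval0 f : peval 0 f = 0. Proof. by rewrite /peval rmorph0 horner0. Qed.

Lemma peval1 f : peval 1 f = 1.
Proof. by rewrite /peval rmorph1 hornerC. Qed.

Lemma pevalD p q f : peval (p + q) f = peval p f + peval q f.
Proof. by rewrite /peval rmorphD hornerD. Qed.

Lemma pevalM p q f : peval (p * q) f = peval p f * peval q f.
Proof. by rewrite /peval rmorphM hornerM. Qed.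

Lemma pevalX f : peval 'X f = f.
Proof. by rewrite /peval map_polyX hornerX. Qed.

Lemma pevalXn n f : peval 'X^n f = f ^+ n.
Proof. by rewrite /peval map_polyXn hornerXn. Qed.

Lemma pevalC a f : peval a%:P f = c a.
Proof. by rewrite /peval map_polyC hornerC. Qed.

Lemma peval_sub p f g : exists h, peval p f - peval p g = (f - g) * h.
Proof.
elim/poly_ind: p => [|p a [h ph]]; first by exists 0; rewrite !peval0 subr0 mulr0.
exists (h * f + peval p g); rewrite !peval_cons.
by rewrite mulrDr mulrA -ph; ring.
Qed.

Lemma peval_deriv (d : A -> A) p f : (forall f g, d (f + g) = d f + d g) ->
  (forall f g, d (f * g) = d f * g + f * d g) -> (forall a, d (c a) = 0) ->
  d (peval p f) = peval p^`() f * d f.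
Proof.
move=> dD dM dC; elim/poly_ind: p => [|p a IHp].
  by have := dC 0; rewrite deriv0 !peval0 mul0r rmorph0.
rewrite peval_cons dD dM dC IHp derivD derivM derivX derivC !addr0 mulr1.
by rewrite pevalD pevalM pevalX; ring.
Qed.

End PolyEval.

(** * Lagrange inversion *)

Section Lagrange.
Variable K : comNzRingType.
Local Notation kappa := (fpsC 'X : fps {poly K}).
Local Notation y := (fpsX : fps {poly K}).
Definition fpsCC : {rmorphism K -> fps {poly K}} := (@fpsC {poly K} \o polyC).
Local Notation "p @ f" := (peval fpsCC p f) (at level 20).

Section FixedPoint.
Variable p : {poly K}.
Hypothesis p_dvd : exists q, p = q * 'X^2.

Let step (f : fps {poly K}) := y + kappa * (p @ f).

Lemma peval_vanish f : vanish 1 f -> vanish 2 (p @ f).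
Proof.
case: p_dvd => q -> f1; rewrite pevalM pevalXn -[2%N]add0n.
by apply: vanishM => //; apply: vanishX.
Qed.

(** As y^2 divides p(y), the step sharpens an agreement modulo y^n of two series
    without constant term to one modulo y^(n+1). *)
Lemma step_contract n f g : vanish 1 f -> vanish 1 g -> vanish n (f - g) ->
  vanish n.+1 (step f - step g).
Proof.
move=> f1 g1 fg; have -> : step f - step g = kappa * (p @ f - p @ g).
  by rewrite /step; ring.
case: p_dvd => q ->; rewrite !(pevalM _ q) !pevalXn.
have [h qfg] := peval_sub fpsCC q f g.
have -> : kappa * (q @ f * f ^+ 2 - q @ g * g ^+ 2) =
  (f - g) * (kappa * (q @ f * (f + g) + h * (g * g))).
  have -> : q @ f = q @ g + (f - g) * h by rewrite -qfg; ring.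
  by ring.
rewrite -addn1; apply: vanishM => //.
rewrite -[1%N]add0n; apply: vanishM => //; apply: vanishD.
  by rewrite -[1%N]add0n; apply: vanishM => //; apply: vanishD.
rewrite -[1%N]add0n; apply: vanishM => //.
exact: vanishMr.
Qed.

(** The iterates of the step stabilise coefficient by coefficient, and the
    series of the stable values is the fixed point. *)
Lemma fixed_point : exists2 f, vanish 1 f & f = step f.
Proof.
pose s n := iter n step 0.
have step1 f : vanish 1 f -> vanish 1 (step f).
  move=> f1; apply: vanishD; first by case.
  rewrite -[1%N]add0n; apply: vanishM => //.
  exact: vanishW (peval_vanish f1).
have s1 n : vanish 1 (s n) by elim: n => [|n IHn] //; apply: step1.
have sS n : vanish n.+1 (s n.+1 - s n).
  elim: n => [|n IHn]; last exact: (step_contract (s1 _) (s1 _) IHn).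
  by rewrite subr0.
have sE m n : (n <= m)%N -> fcoef (s m) n = fcoef (s n) n.
  elim: m => [|m IHm]; first by rewrite leqn0 => /eqP->.
  rewrite leq_eqVlt => /predU1P[->//|lt_nm]; rewrite -(IHm lt_nm).
  by apply/eqP; rewrite -subr_eq0 -fcoefB; apply/eqP/sS.
pose f := FPS (fun n => fcoef (s n) n).
have fs n : vanish n.+1 (f - s n).
  by move=> i lt_in; rewrite fcoefB /= sE ?subrr.
have f1 : vanish 1 f by case=> [|i //] _; apply: (s1 0%N).
exists f => //; apply: vanish_all => n.
have -> : f - step f = (f - s n.+1) - (step f - step (s n)) by rewrite /=; ring.
apply: (@vanishW _ n n.+1) => //; apply: vanishD; first exact: vanishW (fs n.+1).
by apply: vanishN; apply: step_contract => //; apply: vanishW (fs n).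
Qed.
End FixedPoint.

Section Inversion.
Variables (p : {poly K}) (f : fps {poly K}).
Hypothesis fE : f = y + kappa * (p @ f).

(** The derivation d/dkappa of K[kappa][[y]]. *)
Definition dkappa (g : fps {poly K}) : fps {poly K} :=
  FPS (fun n => (fcoef g n)^`()).

Lemma dkappaD g h : dkappa (g + h) = dkappa g + dkappa h.
Proof. by apply: fpsP => n; apply: derivD. Qed.

Lemma dkappaM g h : dkappa (g * h) = dkappa g * h + g * dkappa h.
Proof.
apply: fpsP => n; rewrite fcoefD !fcoefM /= -big_split /=.
by rewrite (raddf_sum (@deriv K)) /=; apply: eq_bigr => i _; rewrite derivM.
Qed.

Lemma dkappaC a : dkappa (fpsCC a) = 0.
Proof. by apply: fpsP => -[|n] /=; rewrite ?derivC ?deriv0. Qed.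

Lemma dkappa_kappa : dkappa kappa = 1.
Proof. by apply: fpsP => -[|n] /=; rewrite ?derivX ?deriv0. Qed.

Lemma dkappa_y : dkappa y = 0.
Proof. by apply: fpsP => n /=; rewrite -polyC_natr derivC. Qed.

Lemma dkappa_deriv g : dkappa (fps_deriv g) = fps_deriv (dkappa g).
Proof. by apply: fpsP => n; apply: derivMn. Qed.

Lemma fps_deriv_peval q g : fps_deriv (q @ g) = (q^`() @ g) * fps_deriv g.
Proof.
apply: peval_deriv; [exact: fps_derivD|exact: fps_derivM|].
by move=> a; apply: fps_derivC.
Qed.

Lemma dkappa_peval q g : dkappa (q @ g) = (q^`() @ g) * dkappa g.
Proof. apply: peval_deriv; [exact: dkappaD|exact: dkappaM|exact: dkappaC]. Qed.

(** The equation df/dkappa = p(f) df/dy. Differentiating the fixed point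
    equation shows that 1 - kappa p'(f) times df/dkappa is p(f), and times df/dy
    is 1; eliminate this factor. *)
Lemma dkappa_fixed : dkappa f = (p @ f) * fps_deriv f.
Proof.
have Dy : fps_deriv f = 1 + kappa * ((p^`() @ f) * fps_deriv f).
  rewrite {1}fE fps_derivD fps_derivX fps_derivM fps_derivC mul0r add0r.
  by rewrite fps_deriv_peval.
have Dk : dkappa f = p @ f + kappa * ((p^`() @ f) * dkappa f).
  rewrite {1}fE dkappaD dkappa_y add0r dkappaM dkappa_kappa mul1r.
  by rewrite dkappa_peval.
transitivity (dkappa f * (fps_deriv f - kappa * ((p^`() @ f) * fps_deriv f))).
  by rewrite {1}Dy addrK mulr1.
transitivity ((dkappa f - kappa * ((p^`() @ f) * dkappa f)) * fps_deriv f).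
  by ring.
by rewrite {1}Dk addrK.
Qed.

(** By the previous equation and the commutation of the two derivations,
    d/dkappa (q(f) df/dy) = d/dy (q(f) df/dkappa) = d/dy ((q p)(f) df/dy)
    for every polynomial q; iterate with q a power of p. *)
Lemma iter_dkappa_fixed n :
  iter n.+1 dkappa f = iter n (@fps_deriv _) (((p ^+ n.+1) @ f) * fps_deriv f).
Proof.
have step q : dkappa ((q @ f) * fps_deriv f) =
    fps_deriv (((q * p) @ f) * fps_deriv f).
  rewrite pevalM -mulrA -dkappa_fixed dkappaM fps_derivM dkappa_deriv.
  by rewrite dkappa_peval fps_deriv_peval; ring.
elim: n => [|n IHn]; first by rewrite /= dkappa_fixed expr1.
rewrite iterS IHn [in RHS]iterSr [p ^+ n.+2]exprSr -step.
by elim: n {IHn} (_ * _) => // n IHn g; rewrite !iterSr IHn dkappa_deriv.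
Qed.

(** Specialisation at kappa = 0. *)
Definition at_kappa0 (g : fps {poly K}) : fps K := FPS (fun n => (fcoef g n)`_0).

Lemma at_kappa0M g h : at_kappa0 (g * h) = at_kappa0 g * at_kappa0 h.
Proof.
apply: fpsP => n; rewrite -[LHS]/(fcoef (g * h) n)`_0 !fcoefM coef_sum.
by apply: eq_bigr => i _; rewrite coef0M.
Qed.

Lemma at_kappa0D g h : at_kappa0 (g + h) = at_kappa0 g + at_kappa0 h.
Proof. by apply: fpsP => n; apply: coefD. Qed.

Lemma at_kappa0_deriv g : at_kappa0 (fps_deriv g) = fps_deriv (at_kappa0 g).
Proof. by apply: fpsP => n; apply: coefMn. Qed.

Lemma at_kappa0_y : at_kappa0 y = fpsX.
Proof. by apply: fpsP => n /=; rewrite -polyC_natr coefC eqxx. Qed.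

Lemma at_kappa0_fixed : at_kappa0 f = fpsX.
Proof.
rewrite fE at_kappa0D at_kappa0_y at_kappa0M.
have -> : at_kappa0 kappa = 0 by apply: fpsP => -[|n] /=; rewrite ?coefX ?coef0.
by rewrite mul0r addr0.
Qed.

Lemma at_kappa0_peval_fixed q n : fcoef (at_kappa0 (q @ f)) n = q`_n.
Proof.
elim/poly_ind: q n => [|q a IHq] n; first by rewrite peval0 /= !coef0.
rewrite peval_cons at_kappa0D at_kappa0M at_kappa0_fixed fcoefD fcoefMX coefD coefMX coefC.
have -> : fcoef (at_kappa0 (fpsCC a)) n = if n == 0%N then a else 0.
  by case: n => [|n] /=; rewrite ?coefC ?coef0.
by case: n => [|n]; rewrite ?IHq.
Qed.

(** Both sides are the coefficient of y^m in the (n+1)-st derivative of f with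
    respect to kappa, at kappa = 0: directly on the left, and on the right
    after trading d/dkappa for d/dy, because f specialises to y. *)
Lemma lagrange_inversion m n :
  (fcoef f m)`_n.+1 *+ n.+1`! = (p ^+ n.+1)`_(m + n) *+ (m + n) ^_ n.
Proof.
have <- : fcoef (at_kappa0 (iter n.+1 dkappa f)) m = (fcoef f m)`_n.+1 *+ n.+1`!.
  have E k (g : fps {poly K}) : fcoef (iter k dkappa g) m = (fcoef g m)^`(k).
    by elim: k => //= k ->.
  by rewrite -[LHS]/((fcoef (iter n.+1 dkappa f) m)`_0) E coef_derivn addn0 ffactnn.
have D k g : at_kappa0 (iter k (@fps_deriv _) g) = iter k (@fps_deriv _) (at_kappa0 g).
  by elim: k => //= k <-; rewrite at_kappa0_deriv.
rewrite iter_dkappa_fixed D fcoef_iter_deriv at_kappa0M at_kappa0_deriv at_kappa0_fixed.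
by rewrite fps_derivX mulr1 at_kappa0_peval_fixed.
Qed.

Lemma fixed_coef0 m : (fcoef f m)`_0 = (m == 1%N)%:R.
Proof. by rewrite -[LHS]/(fcoef (at_kappa0 f) m) at_kappa0_fixed. Qed.
End Inversion.
End Lagrange.

(** * The generating function of genus 0 trees *)

Lemma chi_M0E n : chi_M 0 n = (-1) ^+ n.+1 * (n - 3)`!%:R.
Proof.
rewrite /chi_M muln0 add0n mulr0 sub0r fact0 divr1.
have -> : bernoulli 0 = 1 by rewrite /bernoulli /= big_ord0 subr0 divr1.
by rewrite mulr1 exprSr.
Qed.

Lemma fact_neq0 m : m`!%:R != 0 :> rat.
Proof. by rewrite pnatr_eq0 -lt0n fact_gt0. Qed.

(** The truncation of (1 + x) log (1 + x) - x. *)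
Definition phi (M : nat) : {poly rat} :=
  \poly_(k < M) (if (1 < k)%N then (-1) ^+ k / (k * k.-1)%:R else 0).

Lemma coef_phi M k : (phi M)`_k =
  if (1 < k < M)%N then (-1) ^+ k / (k * k.-1)%:R else 0.
Proof. by rewrite coef_poly; case: (k < M)%N; case: (1 < k)%N. Qed.

Lemma phi_dvd M : exists q, phi M = q * 'X^2.
Proof.
exists (\poly_(k < M - 2) (phi M)`_k.+2); apply/polyP=> k.
rewrite coefMXn; case: ltnP => k2; first by rewrite coef_phi ltnNge -ltnS k2.
rewrite coef_poly ltn_sub2rE // -addn2 subnK // !coef_phi.
by case: (k < M)%N; rewrite ?andbF.
Qed.

Lemma coef_phiX M k i : (i < k.*2)%N -> ((phi M) ^+ k)`_i = 0.
Proof.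
have [q ->] := phi_dvd M => ik.
by rewrite exprMn -exprM coefMXn mul2n ik.
Qed.

(** The exponential generating function of the vertex weights, multiplied by the
    factor d that [card_trees] contributes for a vertex of valence d; the
    weight of an unstable vertex is 0. *)
Lemma coef_Xphi M d : (d <= M)%N ->
  ('X * phi M)`_d *+ d`! = if (2 < d)%N then chi_M 0 d * d%:R else 0.
Proof.
case: d => [|d] dM; rewrite coefXM /=; first by rewrite mul0rn.
rewrite coef_phi dM andbT ltnS; case: ltnP => [d1|_]; last by rewrite mul0rn.
rewrite chi_M0E; case: d d1 dM => [|[|d]] // _ _ /=.
rewrite -mulr_natr !factS !natrM !exprS subSS subSS subSS subn0.
by field; rewrite -(natrD _ 1 d) -(natrD _ 2 d) !pnatr_eq0.
Qed.

(** For a fixed attaching map the vertex weights are constant on the trees, and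
    [card_trees] counts these; then [sum_prod_fibers] sums over the attaching
    maps. *)
Lemma sum_lgraph_weight n k M : (n + k.*2 <= M)%N -> (0 < n)%N ->
  \sum_(x : lgraph k.+1 (n + k.*2) | stable_tree x)
     lgraph_weight x / (k.+1`! * (n + k.*2)`!)%:R =
  (phi M ^+ k.+1)`_(n + k).-1 * (n + k).-1`!%:R / (n`! * k.+1`!)%:R.
Proof.
move=> HM n0; set H := (n + k.*2)%N; rewrite -mulr_suml.
pose d (a : {ffun 'I_H -> 'I_k.+1}) v := valency a setT v.
have val_eq (a : {ffun 'I_H -> 'I_k.+1}) v : #|[set h | a h == v]| = d a v.
  by apply: eq_card => h; rewrite !inE.
have dM (a : {ffun 'I_H -> 'I_k.+1}) v : (d a v <= M)%N.
  by apply: leq_trans HM; rewrite -[leqRHS]card_ord max_card.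
have treesE (a : {ffun 'I_H -> 'I_k.+1}) : [forall v, (2 < d a v)%N] ->
   #|trees a setT setT|%:R = \prod_v (d a v)%:R * (n + k).-1`!%:R / n`!%:R :> rat.
  move=> /forallP d2; rewrite (@card_trees _ _ _ a setT setT k n) ?cardsT ?card_ord //.
    by congr (_ * _ / _); apply: eq_bigl => v; rewrite inE.
  by move=> v _; apply: ltnW; apply: d2.
have -> : \sum_(x : lgraph k.+1 H | stable_tree x) lgraph_weight x =
    (\sum_(a : {ffun 'I_H -> 'I_k.+1}) \prod_v (let d := #|[set h | a h == v]| in
    ('X * phi M)`_d *+ d`!)) * ((n + k).-1`!%:R / n`!%:R).
  rewrite mulr_suml.
  transitivity (\sum_(a : {ffun 'I_H -> 'I_k.+1} | [forall v, (2 < d a v)%N])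
     \sum_(f in trees a setT setT) \prod_v chi_M 0 (d a v)).
    by rewrite pair_big_dep /=; apply: eq_bigl => x; rewrite /stable_tree andbC.
  rewrite big_mkcond; apply: eq_bigr => a _; case: ifPn => [aT|].
    rewrite sumr_const -[LHS]mulr_natr treesE // !mulrA -big_split /=.
    congr (_ * _ / _); apply: eq_bigr => v _.
    by rewrite val_eq coef_Xphi ?(forallP aT).
  by case/forallPn=> v dv; rewrite (bigD1 v) //= val_eq coef_Xphi // (negPf dv) !mul0r.
rewrite sum_prod_fibers prodr_const card_ord exprMn coefXnM.
have -> : (H < k.+1)%N = false by rewrite /H; lia.
have -> : (H - k.+1 = (n + k).-1)%N by rewrite /H; lia.
rewrite -(mulr_natr (_ `_ _) H`!) (natrM _ k.+1`!) (natrM _ n`!).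
move: (fact_neq0 k.+1) (fact_neq0 n) (fact_neq0 H).
move: (k.+1`!%:R) (n`!%:R) (H`!%:R) => a b e a0 b0 e0.
by field; rewrite a0 b0 e0.
Qed.

(** The bound on M makes the truncation of phi invisible: coefficient m comes
    from trees with m + 1 legs, which have at most 3 (m + 1) half-edges. *)
Lemma chi_series_fixed M m f : (3 * m.+1 <= M)%N ->
  f = fpsX + fpsC 'X * peval (fpsCC rat) (phi M) f ->
  fcoef chi_series m = fcoef f m.
Proof.
move=> mM fE; apply/polyP=> i.
rewrite fcoefD /=; case: i => [|k].
  rewrite (fixed_coef0 fE) coefD coefMn coef1.
  by case: ifP => _; rewrite ?coef0 ?addr0 // -mulrA mulrCA coefXM addr0.
have L := lagrange_inversion fE m k.
have k0 : (k.+1`!)%:R != 0 :> rat by rewrite pnatr_eq0 -lt0n fact_gt0.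
apply: (mulIf k0); rewrite [RHS]mulr_natr L coefD coefMn coef1 mul0rn add0r.
case: ifP => m2; last first.
  by rewrite coef0 mul0r coef_phiX ?mul0rn //; lia.
rewrite -mulrA mulr_natl coefMn coefXM /= chi_refined0 coef_sum.
(* A tree with m + 1 legs has at most m vertices; beyond that the power of phi
   vanishes to too high an order. *)
have [km|km] := ltnP k m.+1; last first.
  rewrite coef_phiX; last by lia.
  rewrite big1 ?mul0rn ?mul0r // => j _.
  by rewrite coefZ coefXn; case: eqP => [kj|_]; rewrite ?mulr0 //; have := ltn_ord j; lia.
rewrite (bigD1 (Ordinal km)) //= [X in _ + X]big1 ?addr0; last first.
  move=> j /eqP jk; rewrite coefZ coefXn; case: eqP => [kj|_]; last by rewrite mulr0.
  by case: jk; apply/val_inj.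
rewrite coefZ coefXn eqxx mulr1 (@sum_lgraph_weight _ _ M) //; last by lia.
rewrite addSn /= -[RHS]mulr_natr.
have := ffact_fact (leq_addl m k); rewrite addnK => <-.
rewrite (natrM _ m.+1`!) (natrM _ (_ ^_ _)) (factS m) (natrM _ m.+1).
rewrite -[_ *+ m.+1]mulr_natr.
move: (fact_neq0 k.+1) (fact_neq0 m) => k1 m1.
have m0 : m.+1%:R != 0 :> rat by rewrite pnatr_eq0.
move: (k.+1`!%:R) (m`!%:R) (m.+1%:R) k1 m1 m0 {k0 L} => a b e a0 b0 e0.
by field; rewrite a0 b0 e0.
Qed.

(** The truncation of log (1 + x). *)
Definition log1p_poly (M : nat) : {poly rat} :=
  \poly_(k < M) (if (0 < k)%N then (-1) ^+ k.-1 / k%:R else 0).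

Lemma coef_log1p_poly M k : (log1p_poly M)`_k =
  if (0 < k < M)%N then (-1) ^+ k.-1 / k%:R else 0.
Proof. by rewrite coef_poly; case: (k < M)%N; case: (0 < k)%N. Qed.

(** The identity (1 + x) log (1 + x) = x + phi(x), where truncating leaves one
    extra term of top degree. *)
Lemma log1p_poly_phi M :
  (1 + 'X) * log1p_poly M.+2 = 'X + phi M.+2 + (log1p_poly M.+2)`_M.+1 *: 'X^(M.+2).
Proof.
apply/polyP=> j; rewrite mulrDl mul1r !coefD coefXM coefZ coefX coefXn coef_phi.
rewrite !coef_log1p_poly; case: j => [|[|j]] /=.
- by rewrite mulr0 !addr0.
- by rewrite mulr0 !addr0 expr0 divr1.
rewrite !ltnS leqnn eqSS eqSS; case: (ltngtP j M) => [jM|jM|->]; last first.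
- by rewrite mulr1 !add0r.
- by rewrite mulr0 !addr0.
rewrite mulr0 addr0 add0r natrM !exprS.
by field; rewrite -(natrD _ 1 j) -(natrD _ 2 j) !pnatr_eq0.
Qed.

Lemma fcoef_peval M (p : {poly rat}) (f : fps {poly rat}) n : (size p <= M)%N ->
  fcoef (peval (fpsCC rat) p f) n = \sum_(k < M) p`_k *: fcoef (f ^+ k) n.
Proof.
move=> sp; rewrite /peval (@horner_coef_wide _ M); last by rewrite size_map_poly.
rewrite fcoef_sum; apply: eq_bigr => k _.
by rewrite coef_map [LHS](fcoefCM (p`_k)%:P) mul_polyC.
Qed.

Lemma vanish_exp n (f g : fps {poly rat}) k : vanish n (f - g) ->
  vanish n (f ^+ k - g ^+ k).
Proof. by move=> fg; rewrite subrXX; apply: vanishMr. Qed.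

(** Modulo y^n the logarithm is a polynomial in any series that agrees with its
    argument modulo y^n. *)
Lemma fps_log1p_approx n M (f g : fps {poly rat}) : vanish 1 g ->
  vanish n (f - g) -> (n <= M)%N ->
  vanish n (fps_log1p f - peval (fpsCC rat) (log1p_poly M) g).
Proof.
move=> g1 fg nM i lt_in; apply/eqP; rewrite fcoefB subr_eq0; apply/eqP.
rewrite (@fcoef_peval M) ?size_poly // /=.
rewrite -(big_mkord xpredT (fun k => (log1p_poly M)`_k *: fcoef (g ^+ k) i)).
rewrite [RHS](@big_cat_nat _ _ _ i.+1) ?(leq_trans lt_in) //=.
rewrite [X in _ + X]big_nat_cond [X in _ + X]big1 ?addr0 => [|k /andP[/andP[ik _] _]]; last first.
  by rewrite (vanishX g1) ?scaler0.
rewrite [RHS]big_ltn // coef_log1p_poly /= scale0r add0r.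
apply: eq_big_nat => k /andP[k0 ki].
have kM : (k < M)%N by apply: leq_trans nM; apply: leq_trans lt_in.
rewrite coef_log1p_poly k0 kM; congr (_ *: _); apply/eqP; rewrite -subr_eq0 -fcoefB.
by apply/eqP/(vanish_exp _ fg).
Qed.

Theorem theorem3p8 :
  let kappa : {poly rat} := 'X in
  let y : fps {poly rat} := fpsX in
  let chi : fps {poly rat} := chi_series in
  fpsC kappa * (1 + chi) * fps_log1p chi = fpsC (kappa + 1) * chi - y.
Proof.
move=> kappa y chi; apply: vanish_all => n.
pose M := (3 * n.+2)%N.
have [f f1 fE] := fixed_point (phi_dvd M).
have chif : vanish n (chi - f).
  move=> m mn; rewrite fcoefB (@chi_series_fixed M m f) ?subrr //.
  by rewrite /M; lia.
have nM : (n <= M)%N by rewrite /M; lia.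
have logE := fps_log1p_approx f1 chif nM.
pose L := peval (fpsCC rat) (log1p_poly M) f.
(* Modulo y^n, chi may be replaced by the fixed point f and the logarithm by a
   polynomial in f; what remains is the equation of f. *)
have -> : fpsC kappa * (1 + chi) * fps_log1p chi - (fpsC (kappa + 1) * chi - y) =
   (chi - f) * (fpsC kappa * L - fpsC (kappa + 1)) +
   (fps_log1p chi - L) * (fpsC kappa * (1 + chi)) +
   (fpsC kappa * ((1 + f) * L) - (fpsC (kappa + 1) * f - y)) by ring.
apply: vanishD; first by apply: vanishD; apply: vanishMr.
have [M' ME] : exists M', M = M'.+2 by exists (M - 2)%N; rewrite /M; lia.
have -> : (1 + f) * L = f + peval (fpsCC rat) (phi M) f + fpsCC rat (log1p_poly M)`_M.-1 * f ^+ M.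
  transitivity (peval (fpsCC rat) ((1 + 'X) * log1p_poly M) f).
    by rewrite pevalM pevalD pevalX peval1.
  by rewrite ME log1p_poly_phi !pevalD pevalX -mul_polyC pevalM pevalXn pevalC.
have -> : fpsC (kappa + 1) * f - y =
    fpsC kappa * (f + peval (fpsCC rat) (phi M) f).
  have -> : fpsC kappa * (f + peval (fpsCC rat) (phi M) f) = fpsC kappa * f + (f - y).
    by rewrite mulrDr; congr (_ + _); rewrite [X in X - _]fE addrC addKr.
  by rewrite rmorphD rmorph1; ring.
rewrite mulrDr addrAC subrr add0r mulrA mulrC.
by apply: vanishMr; apply: (vanishW nM); apply: vanishX.
Qed.
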